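(* The following statements are equivalent to each other. (1) The Jacobian conjecture $\mathbf{JC}$ holds. (2) For every $n\ge 1$, $\mathbf{HVC}[n]$ holds for the Laplace operator $\Delta_n=\sum_{i=1}^n D_i^2$. (3) For every $n\ge 1$, $\mathbf{VC}[n]$ holds for the Laplace operator $\Delta_n$. (4) For every $n\ge 1$, $\mathbf{HVC}[n]$ holds for all $\Lambda\in\mathbb{D}_2[n]$. (5) For every $n\ge 1$, $\mathbf{VC}[n]$ holds for all $\Lambda\in\mathbb{D}_2[n]$.
   Context: $\mathcal{A}_n=\mathbb{C}[z_1,\dots,z_n]$ and $D_i=\partial/\partial z_i$. $\mathbb{D}_2[n]$ is the set of homogeneous second order differential operators with constant complex coefficients in $D_1,\dots,D_n$, i.e. operators $\sum_{i,j=1}^n a_{ij}D_iD_j$ with $(a_{ij})$ a symmetric complex $n\times n$ matrix. For a differential operator $\Lambda$ of $\mathcal{A}_n$, a polynomial $P\in\mathcal{A}_n$ is $\Lambda$-nilpotent if $\Lambda^m(P^m)=0$ for all $m\ge 1$. ''$\mathbf{VC}[n]$ holds for $\Lambda$'' means: for every $\Lambda$-nilpotent $P\in\mathcal{A}_n$, one has $\Lambda^m(P^{m+1})=0$ for all sufficiently large $m$. ''$\mathbf{HVC}[n]$ holds for $\Lambda$'' means the same, but only for all homogeneous $\Lambda$-nilpotent $P\in\mathcal{A}_n$. $\mathbf{JC}$ is the statement: for every $n\ge 1$ and every polynomial map $F$ of $\mathbb{C}^n$ with Jacobian determinant $j(F)=1$, the formal inverse map of $F$ is also a polynomial map. *)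

(* Defs.v *)
From mathcomp Require Import all_boot all_order all_algebra.
From mathcomp Require Import reals.
From mathcomp Require Import complex mpoly.

Set Implicit Arguments.
Unset Strict Implicit.
Unset Printing Implicit Defensive.

Import GRing.Theory.
Local Open Scope ring_scope.

(* The field of complex numbers is [R[i]] for [R : realType]. *)

(** Vanishing conjectures *)

Definition laplacian (R : realType) (n : nat) (P : {mpoly R[i][n]}) :
    {mpoly R[i][n]} :=
  \sum_(i < n) P^`M(i)^`M(i).

(* sum_(i, j) a_ij D_i D_j *)
Definition diffop2 (R : realType) (n : nat) (A : 'M[R[i]]_n)
    (P : {mpoly R[i][n]}) : {mpoly R[i][n]} :=
  \sum_(i < n) \sum_(j < n) A i j *: P^`M(j)^`M(i).

Definition is_diffop2 (R : realType) (n : nat)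
    (L : {mpoly R[i][n]} -> {mpoly R[i][n]}) : Prop :=
  exists A : 'M[R[i]]_n, A^T = A /\ L =1 diffop2 A.

Definition op_nilpotent (R : realType) (n : nat)
    (L : {mpoly R[i][n]} -> {mpoly R[i][n]}) (P : {mpoly R[i][n]}) : Prop :=
  forall m : nat, (1 <= m)%N -> iter m L (P ^+ m) = 0.

Definition eventually_vanishing (R : realType) (n : nat)
    (L : {mpoly R[i][n]} -> {mpoly R[i][n]}) (P : {mpoly R[i][n]}) : Prop :=
  exists N : nat, forall m : nat, (N <= m)%N -> iter m L (P ^+ m.+1) = 0.

Definition VC (R : realType) (n : nat)
    (L : {mpoly R[i][n]} -> {mpoly R[i][n]}) : Prop :=
  forall P : {mpoly R[i][n]}, op_nilpotent L P -> eventually_vanishing L P.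

Definition HVC (R : realType) (n : nat)
    (L : {mpoly R[i][n]} -> {mpoly R[i][n]}) : Prop :=
  forall P : {mpoly R[i][n]}, (exists d : nat, P \is d.-homog) ->
    op_nilpotent L P -> eventually_vanishing L P.

(** Formal power series in n variables, given by their coefficients *)

Definition fps (R : realType) (n : nat) : Type := 'X_{1..n} -> R[i].

Definition fps_of_mpoly (R : realType) (n : nat) (p : {mpoly R[i][n]}) :
    fps R n :=
  fun m => p@_m.

Definition fps_trunc (R : realType) (n d : nat) (f : fps R n) :
    {mpoly R[i][n]} :=
  \sum_(m : 'X_{1..n < d}) f m *: 'X_[m].

(* The composition f(g_1, ..., g_n), meaningful when no g_i has a constant
   term: its terms of degree d then depend only on the terms of degree at most
   d of f and of the g_i, so that it can be computed on truncations. *)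
Definition fps_comp (R : realType) (n : nat) (f : fps R n)
    (g : 'I_n -> fps R n) : fps R n :=
  fun m => (fps_trunc (mdeg m).+1 f
              \mPo [tuple fps_trunc (mdeg m).+1 (g i) | i < n])@_m.

Definition fps_var (R : realType) (n : nat) (i : 'I_n) : fps R n :=
  fps_of_mpoly 'X_i.

(** Polynomial maps F = (F_1, ..., F_n) of C^n *)

Definition jacobian (R : realType) (n : nat) (F : 'I_n -> {mpoly R[i][n]}) :
    {mpoly R[i][n]} :=
  \det (\matrix_(i < n, j < n) (F i)^`M(j)).

(* F - F(0), as a map of formal power series without constant terms *)
Definition centered (R : realType) (n : nat) (F : 'I_n -> {mpoly R[i][n]}) :
    'I_n -> fps R n :=
  fun i => fps_of_mpoly (F i - ((F i)@_0%MM)%:MP).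

(* G is the expansion at F(0) of the formal inverse of F: the inverse map is
   F(0) + w |-> G(w), where G(0) = 0 and G is the two-sided compositional
   inverse of z |-> F(z) - F(0).  It exists and is unique when the Jacobian
   determinant of F is 1.  As translations are polynomial maps, the formal
   inverse is polynomial if and only if G is. *)
Definition is_formal_inverse (R : realType) (n : nat)
    (F : 'I_n -> {mpoly R[i][n]}) (G : 'I_n -> fps R n) : Prop :=
  [/\ forall i, G i 0%MM = 0,
      forall i, fps_comp (centered F i) G =1 fps_var R i
    & forall i, fps_comp (G i) (centered F) =1 fps_var R i].

Definition is_polynomial_map (R : realType) (n : nat) (G : 'I_n -> fps R n) :
    Prop :=
  forall i, exists p : {mpoly R[i][n]}, G i =1 fps_of_mpoly p.

Definition JC (R : realType) : Prop :=
  forall n : nat, (1 <= n)%N ->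
  forall F : 'I_n -> {mpoly R[i][n]}, jacobian F = 1 ->
  forall G : 'I_n -> fps R n, is_formal_inverse F G -> is_polynomial_map G.

(* Main.v *)
(* For symmetric A put Lambda = sum a_ij D_i D_j and let Q(t) be the formal
   solution of the Hamilton-Jacobi equation d_t Q = <grad Q, A grad Q> with
   Q(0) = P.  Then N = 2 A grad Q solves the Burgers equation
   d_t N = (N . grad) N, so z + t N is the inverse of z - t H with H = 2 A grad P,
   and d_t log det (1 - t JH) = - (div N)(z - t H), where div N = 2 Lambda Q.
   By the Cole-Hopf transformation, Lambda Q = 0 holds exactly when
   exp (t nu Lambda) exp (P / nu) = exp (Q / nu), which amounts to
   Lambda^m (P^m) = 0 for all m >= 1 and gives
   Q = sum_m t^m Lambda^m (P^(m+1)) / (m! (m+1)!).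
   Hence if P is Lambda-nilpotent then (z, t) |-> (z - t H, t) has Jacobian
   determinant 1, and if its inverse is polynomial then Q is polynomial in t.

   Conversely, let det (1 - t JH) = 1 for an arbitrary H.  Then P = <y, H(x)> / 2
   is nilpotent for Lambda = 2 sum D_(x_i) D_(y_i), with Q = <y, N> / 2, so the
   vanishing conjecture makes the inverse x + t N polynomial.  A map x - H with
   Jacobian determinant 1 and H = sum_(j >= 2) H_j, H_j homogeneous of degree j,
   deforms to x - sum t^(j-1) H_j; the powers of t are made linear by adjoining
   variables v_1, v_2, ..., with x - t (H_2 + v_1), v_1 - t (H_3 + v_2), and so on.

   A general Lambda is pulled back to a Laplace operator by a linear substitution
   in 2n variables, and P is made homogeneous by one further variable. *)

Require Import Defs.
From HB Require Import structures.
From mathcomp Require Import all_boot all_order all_algebra.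
From mathcomp Require Import reals.
From mathcomp Require Import complex mpoly.
From mathcomp Require Import ring zify.

Set Implicit Arguments.
Unset Strict Implicit.
Unset Printing Implicit Defensive.

Import GRing.Theory Num.Theory.
Local Open Scope ring_scope.

Local Notation "p \at g" := (p \mPo [tuple g i | i < _])
  (at level 40, g at level 9, left associativity).

(** * Substitution and congruences *)

Section Glue.
Context (T : Type) (m n : nat) (f : 'I_m -> T) (g : 'I_n -> T).

Definition glue (i : 'I_(m + n)) : T :=
  match split i with inl j => f j | inr j => g j end.

Lemma glue_l i : glue (lshift n i) = f i.
Proof. by rewrite /glue; have /= -> := unsplitK (inl i : 'I_m + 'I_n). Qed.

Lemma glue_r i : glue (rshift m i) = g i.
Proof. by rewrite /glue; have /= -> := unsplitK (inr i : 'I_m + 'I_n). Qed.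

End Glue.

Section Substitution.
Context (K : numFieldType).

(** Constants and variables generate the algebra, so rules for substitution and derivation need only
    be checked on them and propagated through sums and products. *)
Lemma mpoly_ind (n : nat) (T : {mpoly K[n]} -> Prop) :
  (forall c, T c%:MP) -> (forall i, T 'X_i) ->
  (forall p q, T p -> T q -> T (p + q)) ->
  (forall p q, T p -> T q -> T (p * q)) -> forall p, T p.
Proof.
move=> TC TX TD TM; have T1 : T 1 by rewrite -mpolyC1.
have TE m : T 'X_[m].
  rewrite mpolyXE_id; apply: (big_ind T) => // i _.
  by elim: (m i) => [|e IHe]; rewrite ?expr0 // exprS; apply: TM.
elim/mpolyind => [|c m p _ _ Tp]; first by rewrite -mpolyC0.
by apply: TD => //; rewrite -mul_mpolyC; apply: TM.
Qed.

Lemma atX (n k : nat) (g : 'I_n -> {mpoly K[k]}) i : 'X_i \at g = g i.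
Proof. by rewrite comp_mpolyXU -tnth_nth tnth_mktuple. Qed.

Lemma at_id (n : nat) (p : {mpoly K[n]}) : p \at (fun i => 'X_i) = p.
Proof. exact: comp_mpoly_id. Qed.

Lemma eq_at (n k : nat) (g h : 'I_n -> {mpoly K[k]}) p :
  g =1 h -> p \at g = p \at h.
Proof. by move=> gh; congr (_ \mPo _); apply: eq_from_tnth => i; rewrite !tnth_mktuple. Qed.

Lemma at_at (n k l : nat) (g : 'I_n -> {mpoly K[k]}) (h : 'I_k -> {mpoly K[l]}) p :
  (p \at g) \at h = p \at (fun i => g i \at h).
Proof.
elim/mpoly_ind: p => [c|i|p q IHp IHq|p q IHp IHq].
- by rewrite !comp_mpolyC.
- by rewrite !atX.
- by rewrite !comp_mpolyD IHp IHq.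
- by rewrite !rmorphM /= IHp IHq.
Qed.

Lemma mderivXU (n : nat) (i j : 'I_n) :
  ('X_i : {mpoly K[n]})^`M(j) = (i == j)%:R.
Proof.
rewrite mderivX mnm1E; case: eqP => [->|_]; last by rewrite scale0r.
by rewrite -[X in (X - _)%MM]add0m addmK mpolyX0 scale1r.
Qed.

Lemma mderiv_nat (n e : nat) (j : 'I_n) : (e%:R : {mpoly K[n]})^`M(j) = 0.
Proof. by rewrite -mpolyC_nat mderivC. Qed.

Lemma mderiv_at (n k : nat) (g : 'I_n -> {mpoly K[k]}) p j :
  (p \at g)^`M(j) = \sum_i (p^`M(i) \at g) * (g i)^`M(j).
Proof.
elim/mpoly_ind: p => [c|i|p q IHp IHq|p q IHp IHq].
- by rewrite comp_mpolyC mderivC big1 // => i _; rewrite mderivC comp_mpoly0 mul0r.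
- rewrite atX (bigD1 i) //= mderivXU eqxx comp_mpoly1 mul1r big1 ?addr0 // => l ne.
  by rewrite mderivXU eq_sym (negPf ne) comp_mpoly0 mul0r.
- rewrite comp_mpolyD mderivD IHp IHq -big_split; apply: eq_bigr => i _ /=.
  by rewrite mderivD comp_mpolyD mulrDl.
- rewrite rmorphM mderivM IHp IHq mulr_suml mulr_sumr -big_split.
  by apply: eq_bigr => i _ /=; rewrite mderivM comp_mpolyD !rmorphM /=; ring.
Qed.

End Substitution.

(** * Weighted orders of vanishing and the congruences they define *)

Section Order.
Context (K : numFieldType).

(* Two gradings are used: w = 1 gives the order of vanishing at the origin, and
   the indicator of one variable t gives divisibility by powers of t. *)
Definition mweight_by (n : nat) (w : 'I_n -> nat) (m : 'X_{1..n}) : nat :=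
  (\sum_i w i * m i)%N.

Definition ordw (n : nat) (w : 'I_n -> nat) (k : nat) (p : {mpoly K[n]}) : bool :=
  all (fun m => k <= mweight_by w m)%N (msupp p).

Definition eqo (n : nat) (w : 'I_n -> nat) (k : nat) (p q : {mpoly K[n]}) : bool :=
  ordw w k (p - q).

Lemma mweight_by1 (n : nat) (m : 'X_{1..n}) : mweight_by (fun=> 1%N) m = mdeg m.
Proof. by rewrite mdegE /mweight_by; apply: eq_bigr => i _; rewrite mul1n. Qed.

Section OneWeight.
Context (n : nat) (w : 'I_n -> nat).
Implicit Types (p q : {mpoly K[n]}) (m : 'X_{1..n}).

Lemma mweight_byD m1 m2 :
  mweight_by w (m1 + m2)%MM = (mweight_by w m1 + mweight_by w m2)%N.
Proof. by rewrite -big_split; apply: eq_bigr => i _; rewrite mnmDE mulnDr. Qed.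

Lemma mweight_byU i : mweight_by w U_(i)%MM = w i.
Proof.
rewrite /mweight_by (bigD1 i) //= mnm1E eqxx muln1 big1 ?addn0 // => j ne.
by rewrite mnm1E eq_sym (negPf ne) muln0.
Qed.

Lemma ordwP {k p} :
  reflect (forall m, (mweight_by w m < k)%N -> p@_m = 0) (ordw w k p).
Proof.
apply: (iffP allP) => [Hp m lt_m|Hp m].
  by apply/eqP; rewrite mcoeff_eq0; apply: contraL lt_m => /Hp; rewrite -leqNgt.
by rewrite mcoeff_msupp leqNgt; apply: contra => /Hp ->.
Qed.

Lemma ordw0 k : ordw w k 0.
Proof. by apply/ordwP => m _; rewrite mcoeff0. Qed.

Lemma ordw_0 p : ordw w 0 p.
Proof. exact/allP. Qed.

Lemma ordwD k p q : ordw w k p -> ordw w k q -> ordw w k (p + q).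
Proof. by move=> /ordwP Hp /ordwP Hq; apply/ordwP => m lt_m; rewrite mcoeffD Hp ?Hq ?addr0. Qed.

Lemma ordwN k p : ordw w k p -> ordw w k (- p).
Proof. by move=> /ordwP Hp; apply/ordwP => m lt_m; rewrite mcoeffN Hp ?oppr0. Qed.

Lemma ordwZ k c p : ordw w k p -> ordw w k (c *: p).
Proof. by move=> /ordwP Hp; apply/ordwP => m lt_m; rewrite mcoeffZ Hp ?mulr0. Qed.

Lemma ordw_sum k (I : finType) (P : pred I) (F : I -> {mpoly K[n]}) :
  (forall i, P i -> ordw w k (F i)) -> ordw w k (\sum_(i | P i) F i).
Proof.
by move=> HF; apply: (big_ind (ordw w k)) => //; [exact: ordw0 | exact: ordwD].
Qed.

Lemma ordwS k l p : (l <= k)%N -> ordw w k p -> ordw w l p.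
Proof. by move=> le_lk /ordwP Hp; apply/ordwP => m lt_m; apply: Hp; apply: leq_trans le_lk. Qed.

Lemma ordwM k l p q : ordw w k p -> ordw w l q -> ordw w (k + l) (p * q).
Proof.
move=> /ordwP Hp /ordwP Hq; apply/ordwP => m lt_m; rewrite mcoeffM big1 // => -[m1 m2] /= /eqP Em.
have {lt_m}: (mweight_by w m1 + mweight_by w m2 < k + l)%N by rewrite -mweight_byD -Em.
case: (ltnP (mweight_by w m1) k) => [lt1|le1]; first by rewrite Hp ?mul0r.
case: (ltnP (mweight_by w m2) l) => [lt2|le2]; first by rewrite Hq ?mulr0.
by rewrite ltnNge leq_add.
Qed.

Lemma ordwMl k p q : ordw w k q -> ordw w k (p * q).
Proof. by move=> Hq; have := ordwM (ordw_0 p) Hq. Qed.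

Lemma ordwMr k p q : ordw w k p -> ordw w k (p * q).
Proof. by move=> Hp; rewrite mulrC; apply: ordwMl. Qed.

Lemma ordwX i : ordw w (w i) 'X_i.
Proof. by apply/ordwP => m; rewrite mcoeffX; case: eqP => //= <-; rewrite mweight_byU ltnn. Qed.

Lemma ordw_exp k p e : ordw w k p -> ordw w (k * e) (p ^+ e).
Proof.
move=> Hp; elim: e => [|e IHe]; first by rewrite muln0 ordw_0.
by rewrite exprS mulnS; apply: ordwM.
Qed.

Lemma ordw_eq0 p : (forall k, ordw w k p) -> p = 0.
Proof. by move=> Hp; apply/mpolyP => m; rewrite mcoeff0 (ordwP (Hp (mweight_by w m).+1)). Qed.

Lemma ordw_mderiv k p i : ordw w k p -> ordw w (k - w i) p^`M(i).
Proof.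
move=> /ordwP Hp; apply/ordwP => m lt_m; rewrite mcoeff_mderiv Hp ?mul0rn //.
by rewrite mweight_byD mweight_byU addnC -ltn_subRL.
Qed.

Lemma eqo_refl k p : eqo w k p p.
Proof. by rewrite /eqo subrr; apply: ordw0. Qed.

Lemma eqo_mod0 p q : eqo w 0 p q.
Proof. exact: ordw_0. Qed.

Lemma eqo_sym k p q : eqo w k p q -> eqo w k q p.
Proof. by rewrite /eqo -opprB => /ordwN; rewrite opprK. Qed.

Lemma eqo_trans k q p r : eqo w k p q -> eqo w k q r -> eqo w k p r.
Proof. by move=> pq qr; rewrite /eqo -(subrKA q); apply: ordwD. Qed.

Lemma eqoS k l p q : (l <= k)%N -> eqo w k p q -> eqo w l p q.
Proof. exact: ordwS. Qed.

Lemma eqoD k p q p' q' : eqo w k p p' -> eqo w k q q' -> eqo w k (p + q) (p' + q').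
Proof. by move=> Hp Hq; rewrite /eqo opprD addrACA; apply: ordwD. Qed.

Lemma eqoN k p q : eqo w k p q -> eqo w k (- p) (- q).
Proof. by move=> /ordwN; rewrite /eqo opprD. Qed.

Lemma eqoZ k c p q : eqo w k p q -> eqo w k (c *: p) (c *: q).
Proof. by move=> /(ordwZ c); rewrite scalerBr. Qed.

Lemma eqoM k p q p' q' : eqo w k p p' -> eqo w k q q' -> eqo w k (p * q) (p' * q').
Proof.
move=> Hp Hq; rewrite /eqo; have -> : p * q - p' * q' = (p - p') * q + p' * (q - q') by ring.
by apply: ordwD; [apply: ordwMr | apply: ordwMl].
Qed.

Lemma eqo_sum k (I : finType) (P : pred I) (F G : I -> {mpoly K[n]}) :
  (forall i, P i -> eqo w k (F i) (G i)) ->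
  eqo w k (\sum_(i | P i) F i) (\sum_(i | P i) G i).
Proof. by move=> HF; rewrite /eqo -sumrB; apply: ordw_sum. Qed.

Lemma eqo_exp k e p q : eqo w k p q -> eqo w k (p ^+ e) (q ^+ e).
Proof.
move=> Hp; elim: e => [|e IHe]; first exact: eqo_refl.
by rewrite !exprS; apply: eqoM.
Qed.

Lemma eqo_mderiv k p q i : w i = 0 -> eqo w k p q -> eqo w k p^`M(i) q^`M(i).
Proof. by move=> wi /(@ordw_mderiv _ _ i); rewrite wi subn0 mderivB. Qed.

Lemma ordw_eqo0 k p : ordw w k p -> eqo w k p 0.
Proof. by rewrite /eqo subr0. Qed.

Lemma eqo_eq p q : (forall k, eqo w k p q) -> p = q.
Proof. by move=> pq; apply/subr0_eq/ordw_eq0. Qed.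

Lemma eqo_at k l (g h : 'I_l -> {mpoly K[n]}) (p : {mpoly K[l]}) :
  (forall i, eqo w k (g i) (h i)) -> eqo w k (p \at g) (p \at h).
Proof.
move=> gh; elim/mpoly_ind: p => [c|i|p q IHp IHq|p q IHp IHq].
- by rewrite !comp_mpolyC; apply: eqo_refl.
- by rewrite !atX.
- by rewrite !comp_mpolyD; apply: eqoD.
- by rewrite !rmorphM; apply: eqoM.
Qed.

(** In characteristic 0 the derivative in [o] determines every monomial that contains [o]; order 1
    takes care of the monomials free of [o]. This is integration in t, by which solutions of
    differential equations are compared below. *)
Lemma ordw_integral k (o : 'I_n) p :
  (forall i, w i = (i == o)) -> ordw w 1 p -> ordw w k p^`M(o) -> ordw w k.+1 p.
Proof.
move=> wE /ordwP H1 /ordwP Hk; apply/ordwP => m lt_m; have wm m' : mweight_by w m' = m' o.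
  rewrite /mweight_by (bigD1 o) //= wE eqxx mul1n big1 ?addn0 // => i ne.
  by rewrite wE (negPf ne).
case: (posnP (m o)) => [m0|m_gt0]; first by rewrite H1 // wm m0.
have Um : (U_(o) <= m)%MM by rewrite lep1mP -lt0n.
have := Hk (m - U_(o))%MM; rewrite mcoeff_mderiv submK // => H.
have {H} /eqP : p@_m *+ (((m - U_(o))%MM) o).+1 = 0.
  apply: H; move: lt_m; rewrite !wm mnmBE mnm1E eqxx subn1.
  by case: (m o) m_gt0.
by rewrite mulrn_eq0 /= => /eqP.
Qed.

End OneWeight.

Arguments ordwP {n w k p}.

Lemma ordw_at (n l : nat) (w : 'I_n -> nat) (v : 'I_l -> nat) k
    (g : 'I_n -> {mpoly K[l]}) (p : {mpoly K[n]}) :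
  (forall i, ordw v (w i) (g i)) -> ordw w k p -> ordw v k (p \at g).
Proof.
move=> Hg Hp; rewrite comp_mpolyE big_seq.
apply: (big_ind (ordw v k)) => [||m]; [exact: ordw0 | exact: ordwD |].
rewrite mcoeff_msupp => pm; apply: ordwZ.
have le_k : (k <= mweight_by w m)%N.
  by rewrite leqNgt; apply: contra pm => /(ordwP Hp) ->.
apply: ordwS le_k _; rewrite /mweight_by.
elim/big_ind2: _ => [|e1 p1 e2 p2 H1 H2|i _]; [exact: ordw_0 | exact: ordwM |].
by rewrite tnth_mktuple; apply: ordw_exp.
Qed.

Lemma eqo_at_l (n l : nat) (w : 'I_n -> nat) (v : 'I_l -> nat) k
    (g : 'I_n -> {mpoly K[l]}) (p q : {mpoly K[n]}) :
  (forall i, ordw v (w i) (g i)) -> eqo w k p q -> eqo v k (p \at g) (q \at g).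
Proof. by move=> Hg /(ordw_at Hg); rewrite comp_mpolyB. Qed.

End Order.

Arguments ordwP {K n w k p}.
#[local] Hint Resolve ordw_0 ordw0 eqo_mod0 eqo_refl : core.

(** * Inverse maps and the Burgers equation *)

Section Burgers.
Context (K : numFieldType).

Lemma mderiv_prod (n : nat) (o : 'I_n) (I : finType) (F : I -> {mpoly K[n]}) :
  (\prod_i F i)^`M(o) = \sum_i (F i)^`M(o) * \prod_(j | j != i) F j.
Proof.
(* In a list without duplicates the filter [j != i] removes exactly one factor, which permits
   induction on the list. *)
suff H (s : seq I) : uniq s ->
    (\prod_(i <- s) F i)^`M(o) = \sum_(i <- s) (F i)^`M(o) * \prod_(j <- s | j != i) F j.
  by rewrite H ?index_enum_uniq.
elim: s => [_|a s IHs /= /andP[a_s /IHs IH]].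
  by rewrite !big_nil -mpolyC1 mderivC.
rewrite !big_cons mderivM IH eqxx /=; congr (_ + _).
  congr (_ * _); rewrite [RHS]big_seq_cond [LHS]big_seq; apply: eq_bigl => j.
  by case js : (j \in s) => //=; apply/esym; apply: contraTneq js => ->.
rewrite mulr_sumr big_seq [RHS]big_seq; apply: eq_bigr => i is_.
rewrite big_cons; have -> : a != i by apply: contraNneq a_s => ->.
by rewrite mulrCA.
Qed.

(** Jacobi's formula. By multilinearity one row is differentiated at a time. *)
Lemma mderiv_det (n m : nat) (o : 'I_n) (A : 'M[{mpoly K[n]}]_m) :
  (\det A)^`M(o) = \tr (\adj A *m map_mx (mderiv o) A).
Proof.
(* Differentiating row i leaves the cofactors along that row unchanged, so expansion along it
   produces the adjugate of [A]. *)
pose B (i : 'I_m) : 'M[{mpoly K[n]}]_m :=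
  \matrix_(k, l) if k == i then (A k l)^`M(o) else A k l.
have BA i j : cofactor (B i) i j = cofactor A i j.
  congr (_ * \det _); apply/matrixP => k l; rewrite !mxE.
  by rewrite eq_sym (negPf (neq_lift _ _)).
transitivity (\sum_i \det (B i)).
  rewrite /determinant raddf_sum exchange_big /=; apply: eq_bigr => s _.
  have sC (b : bool) : (-1) ^+ b = ((-1) ^+ b)%:MP :> {mpoly K[n]}.
    by rewrite rmorphXn rmorphN1.
  rewrite -mulr_sumr sC mderiv_mulC mderiv_prod; congr (_ * _); apply: eq_bigr => i _.
  rewrite [RHS](bigD1 i) //= mxE eqxx; congr (_ * _); apply: eq_bigr => j ne.
  by rewrite mxE (negPf ne).
under eq_bigr => i _ do rewrite (expand_det_row _ i).
under eq_bigr => i _ do under eq_bigr => j _ do rewrite BA mxE eqxx mulrC.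
rewrite exchange_big; apply: eq_bigr => j _; rewrite mxE.
by apply: eq_bigr => i _; rewrite !mxE.
Qed.

Section Flow.
Context (n : nat) (o : 'I_n).
Local Notation S := {mpoly K[n]}.
Local Notation t := ('X_o : S).
Implicit Types (p q : S) (H N : 'I_n -> S).

(* t is a time parameter carried as one of the polynomial variables, and
   [eqo wt k] is congruence modulo t^k. *)
Definition wt (i : 'I_n) : nat := i == o.

(** Column [o] is zero because t is a parameter: this is the Jacobian matrix in the other
    variables. *)
Definition rJ H : 'M[S]_n :=
  \matrix_(i, j) if j == o then 0 else (H i)^`M(j).

Definition rdiv H : S := \sum_(i | i != o) (H i)^`M(i).

Definition fwd H (i : 'I_n) : S := 'X_i - t * H i.
Definition bwd H (i : 'I_n) : S := 'X_i + t * H i.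

Definition rjac H : S := \det (1%:M - t *: rJ H).

Lemma ordw_t k p : ordw wt k p -> ordw wt k.+1 (t * p).
Proof.
move=> Hp; rewrite -add1n; apply: ordwM => //.
by have := @ordwX K _ wt o; rewrite /wt eqxx.
Qed.

Lemma eqo_t k p q : eqo wt k p q -> eqo wt k.+1 (t * p) (t * q).
Proof. by move=> /ordw_t; rewrite mulrBr. Qed.

Lemma wt_other j : j != o -> wt j = 0%N.
Proof. by rewrite /wt => /negPf ->. Qed.

Lemma ordw_bwd H i : H o = 0 -> ordw wt (wt i) (bwd H i).
Proof.
move=> Ho; rewrite /bwd; case: (eqVneq i o) => [->|ne].
  by rewrite Ho mulr0 addr0; apply: ordwX.
by rewrite wt_other // ordw_0.
Qed.

Lemma ordw_fwd H i : H o = 0 -> ordw wt (wt i) (fwd H i).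
Proof.
move=> Ho; rewrite /fwd; case: (eqVneq i o) => [->|ne].
  by rewrite Ho mulr0 subr0; apply: ordwX.
by rewrite wt_other // ordw_0.
Qed.

Lemma eqo_bwd k H N i :
  eqo wt k (H i) (N i) -> eqo wt k.+1 (bwd H i) (bwd N i).
Proof. by move=> HN; apply: eqoD; [apply: eqo_refl | apply: eqo_t]. Qed.

Lemma t_bwd H : H o = 0 -> t \at (bwd H) = t.
Proof. by move=> Ho; rewrite atX /bwd Ho mulr0 addr0. Qed.

Lemma t_fwd H : H o = 0 -> t \at (fwd H) = t.
Proof. by move=> Ho; rewrite atX /fwd Ho mulr0 subr0. Qed.

(** Picard iteration from 0: [bwd] multiplies N by t, so each iteration gains one power of t. *)
Lemma fixpoint_ex H k : H o = 0 ->
  exists N, N o = 0 /\ forall i, eqo wt k (N i) (H i \at (bwd N)).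
Proof.
move=> Ho; elim: k => [|k [N [No HN]]]; first by exists (fun=> 0).
exists (fun i => H i \at (bwd N)); split=> [|i]; first by rewrite Ho comp_mpoly0.
by apply: eqo_at => l; apply: eqo_bwd; apply: HN.
Qed.

(* N = H(z + t N) says that z + t N is the inverse of z - t H; as t varies it is
   the solution of the Burgers equation d_t N = (N . grad) N with N(0) = H. *)
Section FlowEquations.
Context (H N : 'I_n -> S).
Hypotheses (Ho : H o = 0) (No : N o = 0).

(** Substituting z - t H into N = H(z + t N) gives N(z - t H) = H(z + t (N(z - t H) - H)), so the
    error N(z - t H) - H controls itself with an additional factor t. *)
Lemma fixpoint_fwd k :
  (forall i, eqo wt k (N i) (H i \at (bwd N))) ->
  forall i, eqo wt k (N i \at (fwd H)) (H i).
Proof.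
move=> HN; suff S j : (j <= k)%N -> forall i, eqo wt j (N i \at (fwd H)) (H i) by exact: S.
elim: j => [//|j IHj] lt_jk i.
apply: eqo_trans (eqoS lt_jk (eqo_at_l _ (HN i))) _.
  by move=> l; apply: ordw_fwd.
rewrite at_at -[X in eqo _ _ _ X]at_id; apply: eqo_at => l.
rewrite /bwd comp_mpolyD rmorphM /= t_fwd // atX /fwd.
rewrite /eqo [X in ordw _ _ X](_ : _ = t * (N l \at (fwd H) - H l)); last by ring.
by apply: ordw_t; apply: IHj; apply: ltnW.
Qed.

Lemma fixpoint_bwd k :
  (forall i, eqo wt k (N i) (H i \at (bwd N))) ->
  forall i, eqo wt k.+1 (fwd H i \at (bwd N)) 'X_i.
Proof.
move=> HN i; rewrite /fwd comp_mpolyB rmorphM /= t_bwd // atX /bwd.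
rewrite /eqo [X in ordw _ _ X](_ : _ = t * (N i - H i \at (bwd N))); last by ring.
by apply: ordw_t; apply: HN.
Qed.

Lemma fixpoint_fwd_bwd k :
  (forall i, eqo wt k (N i) (H i \at (bwd N))) ->
  forall i, eqo wt k.+1 (bwd N i \at (fwd H)) 'X_i.
Proof.
move=> HN i; rewrite /bwd comp_mpolyD rmorphM /= t_fwd // atX /fwd.
rewrite /eqo [X in ordw _ _ X](_ : _ = t * (N i \at (fwd H) - H i)); last by ring.
by apply: ordw_t; apply: fixpoint_fwd.
Qed.

Definition advect i : S := \sum_j (N i)^`M(j) * N j.

Hypothesis dH : forall i, (H i)^`M(o) = 0.

Lemma mderiv_bwd l j :
  (bwd N l)^`M(j) = (l == j)%:R + (o == j)%:R * N l + t * (N l)^`M(j).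
Proof. by rewrite /bwd mderivD mderivM !mderivXU addrA. Qed.

Lemma mderiv_o_at_bwd i :
  (H i \at (bwd N))^`M(o) =
  \sum_l ((H i)^`M(l) \at (bwd N)) * (N l + t * (N l)^`M(o)).
Proof.
rewrite mderiv_at; apply: eq_bigr => l _; rewrite mderiv_bwd eqxx mul1r.
case: (eqVneq l o) => [->|ne]; first by rewrite dH comp_mpoly0 !mul0r.
by rewrite add0r.
Qed.

(** Same shape as [mderiv_o_at_bwd], with [advect] in place of the t-derivative of N. That term
    carries a factor t, which yields the gain of one order in the next two inductions. *)
Lemma advect_at_bwd i :
  \sum_j (H i \at (bwd N))^`M(j) * N j =
  \sum_l ((H i)^`M(l) \at (bwd N)) * (N l + t * advect l).
Proof.
under eq_bigr => j _ do rewrite mderiv_at mulr_suml.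
rewrite exchange_big; apply: eq_bigr => l _ /=.
rewrite /advect mulrDr mulrA [in RHS]mulr_sumr.
rewrite [X in X + _](_ : _ = \sum_j ((H i)^`M(l) \at (bwd N)) * ((l == j)%:R * N j)); last first.
  rewrite (bigD1 l) //= eqxx mul1r big1 ?addr0 // => j ne.
  by rewrite eq_sym (negPf ne) mul0r mulr0.
rewrite -big_split; apply: eq_bigr => j _ /=; rewrite mderiv_bwd.
case: (eqVneq j o) => [->|ne]; first by rewrite No !mulr0 add0r.
by rewrite ?[o == j]eq_sym ?(negPf ne) /=; ring.
Qed.

(** If d_t N and (N . grad) N agree to order j, the two expansions above make them agree to order j
    + 1. One order is lost at the start, by differentiating the fixpoint equation in t. *)
Lemma fixpoint_burgers k :
  (forall i, eqo wt k.+1 (N i) (H i \at (bwd N))) ->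
  forall i, eqo wt k (N i)^`M(o) (advect i).
Proof.
move=> HN; suff S j : (j <= k)%N -> forall i, eqo wt j (N i)^`M(o) (advect i) by exact: S.
elim: j => [//|j IHj] lt_jk i.
have dN : eqo wt k (N i)^`M(o) (H i \at (bwd N))^`M(o).
  have := @ordw_mderiv _ _ _ _ _ o (HN i).
  by rewrite /wt eqxx subn1 mderivB.
have aN : eqo wt k (advect i) (\sum_l (H i \at (bwd N))^`M(l) * N l).
  apply: eqo_sum => l _; case: (eqVneq l o) => [->|ne].
    by rewrite No !mulr0; apply: eqo_refl.
  apply: eqoM; last exact: eqo_refl.
  by apply: eqo_mderiv; [rewrite wt_other | apply: eqoS (HN i)].
apply: eqo_trans (eqoS lt_jk dN) _; apply: eqo_sym.
apply: eqo_trans (eqoS lt_jk aN) _; apply: eqo_sym.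
rewrite mderiv_o_at_bwd advect_at_bwd; apply: eqo_sum => l _.
apply: eqoM; first exact: eqo_refl.
apply: eqoD; first exact: eqo_refl.
by apply: eqo_t; apply: IHj; apply: ltnW.
Qed.

(** Both sides agree at t = 0, so it suffices to compare their t-derivatives: the Burgers equation
    turns each of them into a transport term, and these agree by induction. *)
Lemma burgers_fixpoint k :
  (forall i, eqo wt 1 (N i) (H i)) ->
  (forall i, eqo wt k (N i)^`M(o) (advect i)) ->
  forall i, eqo wt k.+1 (N i) (H i \at (bwd N)).
Proof.
move=> N0 BN.
suff S j : (j <= k)%N -> forall i, eqo wt j.+1 (N i) (H i \at (bwd N)) by exact: S.
have E1 i : eqo wt 1 (N i) (H i \at (bwd N)).
  apply: eqo_trans (N0 i) _; rewrite -[X in eqo _ _ X]at_id; apply: eqo_at => l.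
  rewrite /eqo /bwd opprD addNKr; apply: ordwN; exact: ordw_t.
elim: j => [//|j IHj] lt_jk i.
apply: ordw_integral (E1 i) _; first by [].
rewrite mderivB; apply: eqo_trans (eqoS lt_jk (BN i)) _.
rewrite mderiv_o_at_bwd.
apply: (@eqo_trans _ _ _ _ (\sum_l (H i \at (bwd N))^`M(l) * N l)); last first.
  rewrite advect_at_bwd; apply: eqo_sum => l _; apply: eqoM; first exact: eqo_refl.
  apply: eqoD; first exact: eqo_refl.
  by apply: (@eqoS _ _ _ j.+2) => //; apply: eqo_t; apply: eqo_sym; apply: eqoS (BN l).
apply: eqo_sum => l _; case: (eqVneq l o) => [->|ne].
  by rewrite No !mulr0; apply: eqo_refl.
apply: eqoM; last exact: eqo_refl.
by apply: eqo_mderiv; [rewrite wt_other | apply: IHj; apply: ltnW].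
Qed.

(** The chain rule: 1 - t JH is the Jacobian matrix of z - t H in the variables other than t. *)
Lemma rJ_fwd : map_mx (fun p => p \at (fwd H)) (rJ N) *m (1%:M - t *: rJ H) =
  rJ (fun i => N i \at (fwd H)).
Proof.
apply/matrixP => i j; rewrite !mxE; under eq_bigr => l _ do rewrite !mxE.
case: (eqVneq j o) => [->|ne].
  rewrite big1 // => l _; rewrite mulr0 subr0.
  by case: eqVneq => [_|_]; rewrite ?raddf0 ?mul0r ?mulr0.
rewrite mderiv_at; apply: eq_bigr => l _.
case: (eqVneq l o) => [->|ne']; last first.
  rewrite /fwd mderivB mderivM !mderivXU.
  by rewrite [o == j]eq_sym (negPf ne) mul0r add0r.
by rewrite comp_mpoly0 mul0r /fwd Ho mulr0 subr0 mderivXU eq_sym (negPf ne) mulr0.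
Qed.

(** With M = 1 - t JH, Jacobi's formula gives - tr (adj M JH). Since N(z - t H) = H, [rJ_fwd]
    rewrites JH as JN(z - t H) M, and M adj M = det M leaves the trace of JN(z - t H), which is the
    divergence. The derivatives replaced here are not in t, so no order is lost. *)
Lemma mderiv_rjac k :
  (forall i, eqo wt k (N i) (H i \at (bwd N))) ->
  eqo wt k (rjac H)^`M(o) (- ((rdiv N \at (fwd H)) * rjac H)).
Proof.
move=> HN; rewrite /rjac; set M := 1%:M - _.
have dM : map_mx (mderiv o) M = - rJ H.
  apply/matrixP => i j; rewrite !mxE mderivB mderivM mderivXU eqxx mul1r.
  rewrite mderiv_nat sub0r.
  by case: eqVneq => _; rewrite ?mderiv0 ?mulr0 ?addr0 // mderiv_comm dH mderiv0 mulr0 addr0.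
rewrite mderiv_det dM mulmxN raddfN; apply: eqoN.
have trE : rdiv N \at (fwd H) * \det M =
    \tr (\adj M *m rJ (fun i => N i \at (fwd H))).
  rewrite -rJ_fwd mulmxA mxtrace_mulC mulmxA mul_mx_adj mul_scalar_mx linearZ /= mulrC.
  congr (_ * _); rewrite /rdiv raddf_sum big_mkcond /mxtrace; apply: eq_bigr => i _.
  by rewrite !mxE; case: eqVneq; rewrite ?raddf0.
rewrite trE; apply: eqo_sum => i _; rewrite !mxE; apply: eqo_sum => j _.
apply: eqoM; first exact: eqo_refl.
rewrite !mxE; case: eqVneq => [_|ne]; first exact: eqo_refl.
apply: eqo_mderiv; first by rewrite wt_other.
by apply: eqo_sym; apply: fixpoint_fwd.
Qed.

End FlowEquations.
End Flow.
End Burgers.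

(** * Quadratic operators and the Hamilton-Jacobi equation *)

Section SecondOrder.
Context (K : numFieldType).

Section Operator.
Context (n : nat) (A : 'M[K]_n).
Local Notation S := {mpoly K[n]}.
Implicit Types (p q : S).

Definition lam p : S := \sum_i \sum_j A i j *: p^`M(j)^`M(i).

Definition bil p q : S := \sum_i \sum_j A i j *: (p^`M(j) * q^`M(i)).

(** The coefficient of nu^(-e) in exp (p / nu). *)
Definition divpow e p : S := (e`!)%:R^-1 *: p ^+ e.

Lemma lam_is_linear : linear lam.
Proof.
move=> c p q; rewrite /lam scaler_sumr -big_split; apply: eq_bigr => i _ /=.
rewrite scaler_sumr -big_split; apply: eq_bigr => j _ /=.
by rewrite !mderivD !mderivZ scalerDr !scalerA mulrC.
Qed.

HB.instance Definition _ := GRing.isLinear.Build K S S _ lam lam_is_linear.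

Lemma divpow0 p : divpow 0 p = 1.
Proof. by rewrite /divpow fact0 invr1 scale1r. Qed.

Lemma divpow1 p : divpow 1 p = p.
Proof. by rewrite /divpow factS fact0 invr1 scale1r. Qed.

Lemma mderiv_divpow e p i : (divpow e.+1 p)^`M(i) = divpow e p * p^`M(i).
Proof.
have H : (p ^+ e.+1)^`M(i) = (e.+1)%:R *: (p ^+ e * p^`M(i)).
  elim: e => [|e IHe]; first by rewrite scale1r mul1r.
  rewrite exprS mderivM IHe -scalerAr mulrA -exprS mulrC -[X in X + _]scale1r.
  by rewrite -scalerDl nat1r.
rewrite /divpow mderivZ H scalerA -scalerAl; congr (_ *: _).
by rewrite factS natrM invfM mulrAC mulVf ?mul1r // pnatr_eq0.
Qed.

(** Coefficient form of Lambda exp (p / nu) = (Lambda p / nu + <grad p, A grad p> / nu^2) exp (p /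
    nu). *)
Lemma lam_divpow e p :
  lam (divpow e.+2 p) = divpow e.+1 p * lam p + divpow e p * bil p p.
Proof.
rewrite /lam /bil !mulr_sumr -big_split; apply: eq_bigr => i _ /=.
rewrite !mulr_sumr -big_split; apply: eq_bigr => j _ /=.
rewrite mderiv_divpow mderivM mderiv_divpow -!scalerAr -scalerDr.
by congr (_ *: _); ring.
Qed.

Lemma bilC p q : A^T = A -> bil p q = bil q p.
Proof.
move=> At; rewrite /bil exchange_big; apply: eq_bigr => i _; apply: eq_bigr => j _.
by rewrite -{1}At mxE mulrC.
Qed.

Lemma eqo_divpow w k e p q : eqo w k p q -> eqo w k (divpow e p) (divpow e q).
Proof. by move=> pq; apply/eqoZ/eqo_exp. Qed.

Lemma iter_lamZ m c p : iter m lam (c *: p) = c *: iter m lam p.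
Proof. by elim: m => [//|m IHm]; rewrite !iterS IHm linearZ. Qed.

End Operator.

Section Series.
Context (n : nat) (o : 'I_n).
Local Notation S := {mpoly K[n]}.
Local Notation t := ('X_o : S).

Lemma mweight_by_wt (m : 'X_{1..n}) : mweight_by (wt o) m = m o.
Proof.
rewrite /mweight_by (bigD1 o) //= /wt eqxx mul1n big1 ?addn0 // => i ne.
by rewrite (negPf ne).
Qed.

Lemma mcoeff_const (p : S) (m : 'X_{1..n}) : p^`M(o) = 0 -> (0 < m o)%N -> p@_m = 0.
Proof.
move=> dp m_gt0; have Um : (U_(o) <= m)%MM by rewrite lep1mP -lt0n.
have /eqP := mcoeff_mderiv o p (m - U_(o))%MM.
by rewrite dp mcoeff0 submK // eq_sym mulrn_eq0 /= => /eqP.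
Qed.

Lemma ordw_tX k (p : S) : ordw (wt o) k (t ^+ k * p).
Proof.
apply: ordwMr; have := @ordw_exp _ _ (wt o) (wt o o) t k (@ordwX _ _ _ o).
by rewrite /wt eqxx mul1n.
Qed.

(** Only the term of index r meets a monomial with t-exponent r: later terms have too high an order
    in t, and earlier ones would need a power of t inside [f k]. *)
Lemma mcoeff_series (f : nat -> S) M r (m : 'X_{1..n}) :
  (forall k, (f k)^`M(o) = 0) -> m o = 0%N -> (r < M)%N ->
  (\sum_(k < M) t ^+ k * f k)@_(m + U_(o) *+ r)%MM = (f r)@_m.
Proof.
move=> df mo lt_r; have wm : mweight_by (wt o) (m + U_(o) *+ r)%MM = r.
  by rewrite mweight_by_wt mnmDE mulmnE mnm1E eqxx mo mul1n.
rewrite raddf_sum (bigD1 (Ordinal lt_r)) //= mpolyXn mulrC addmC mcoeffMX.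
rewrite big1 ?addr0 // => k; rewrite -val_eqE /= => ne.
case: (ltnP r k) => [lt_rk|le_kr].
  by rewrite addmC (ordwP (ordw_tX k (f k))) // wm.
have lt_kr : (k < r)%N by rewrite ltn_neqAle ne.
rewrite mpolyXn mulrC.
have -> : (U_(o) *+ r + m = U_(o) *+ k + (U_(o) *+ (r - k) + m))%MM.
  by apply/mnmP => i; rewrite !mnmDE !mulmnE addnA -mulnDr subnKC.
rewrite mcoeffMX; apply: mcoeff_const => //.
by rewrite mnmDE mulmnE mnm1E eqxx mul1n addn_gt0 subn_gt0 lt_kr.
Qed.

Lemma series_eq0 (f : nat -> S) M :
  (forall k, (f k)^`M(o) = 0) -> ordw (wt o) M (\sum_(k < M) t ^+ k * f k) ->
  forall r, (r < M)%N -> f r = 0.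
Proof.
move=> df ord_f r lt_r; apply/mpolyP => m; rewrite mcoeff0.
case: (posnP (m o)) => [mo|]; last exact: mcoeff_const.
rewrite -(mcoeff_series df mo lt_r) (ordwP ord_f) // mweight_by_wt mnmDE mulmnE mnm1E eqxx.
by rewrite mo mul1n.
Qed.

Context (A : 'M[K]_n).
Hypotheses (Aol : forall j, A o j = 0) (Aor : forall i, A i o = 0).

Lemma ordw_lam k p : ordw (wt o) k p -> ordw (wt o) k (lam A p).
Proof.
move=> Hp; apply: ordw_sum => i _; apply: ordw_sum => j _.
case: (eqVneq i o) => [->|ni]; first by rewrite Aol scale0r; apply: ordw0.
case: (eqVneq j o) => [->|nj]; first by rewrite Aor scale0r; apply: ordw0.
apply: ordwZ; have := @ordw_mderiv _ _ _ _ _ i (@ordw_mderiv _ _ _ _ _ j Hp).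
by rewrite !wt_other // !subn0.
Qed.

Lemma eqo_lam k p q : eqo (wt o) k p q -> eqo (wt o) k (lam A p) (lam A q).
Proof. by move=> /ordw_lam; rewrite linearB. Qed.

Lemma mderiv_lam p : (lam A p)^`M(o) = lam A p^`M(o).
Proof.
rewrite /lam raddf_sum; apply: eq_bigr => i _ /=.
rewrite raddf_sum; apply: eq_bigr => j _ /=; rewrite mderivZ; congr (_ *: _).
by rewrite mderiv_comm; congr (_^`M(_)); rewrite mderiv_comm.
Qed.

(** Row and column [o] of [A] vanish, so Lambda does not differentiate in t and factors depending on
    t alone come out. *)
Lemma lam_mul_const (u p : S) : (forall i, i != o -> u^`M(i) = 0) ->
  lam A (u * p) = u * lam A p.
Proof.
move=> du; rewrite /lam mulr_sumr; apply: eq_bigr => i _.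
rewrite mulr_sumr; apply: eq_bigr => j _.
case: (eqVneq i o) => [->|ni]; first by rewrite Aol !scale0r mulr0.
case: (eqVneq j o) => [->|nj]; first by rewrite Aor !scale0r mulr0.
by rewrite -scalerAr mderivM du // mul0r add0r mderivM du // mul0r add0r.
Qed.

Lemma mderiv_divpow_t e i : i != o -> (divpow e t)^`M(i) = 0.
Proof.
move=> ne; case: e => [|e]; first by rewrite divpow0 -mpolyC1 mderivC.
by rewrite mderiv_divpow mderivXU eq_sym (negPf ne) mulr0.
Qed.

Variable P : S.
Hypothesis dP : P^`M(o) = 0.

(* The coefficient of nu^(-e), truncated modulo t^M, of
   exp (t nu Lambda) (exp (P / nu)), where Lambda = [lam A]. *)
Definition heat M e : S :=
  \sum_(k < M) divpow k t * iter k (lam A) (divpow (e + k) P).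

Lemma mderiv_iter_lam k e : (iter k (lam A) (divpow e P))^`M(o) = 0.
Proof.
elim: k => [|k IHk]; last by rewrite iterS mderiv_lam IHk linear0.
case: e => [|e]; first by rewrite divpow0 -mpolyC1 mderivC.
by rewrite mderiv_divpow dP mulr0.
Qed.

(** The heat equation d_t = nu Lambda: the factor nu moves the index from e to e + 1, and
    differentiation costs one term of the truncation. *)
Lemma mderiv_heat M e : (heat M.+1 e)^`M(o) = lam A (heat M e.+1).
Proof.
rewrite /heat !raddf_sum /=.
under eq_bigr => k _ do rewrite mderivM mderiv_iter_lam mulr0 addr0.
rewrite big_ord_recl divpow0 -mpolyC1 mderivC mul0r add0r; apply: eq_bigr => k _.
rewrite mderiv_divpow mderivXU eqxx mulr1.
rewrite lam_mul_const => [|i ne]; last exact: mderiv_divpow_t.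
by rewrite /= addSnnS.
Qed.

Lemma heatS M e : eqo (wt o) M (heat M.+1 e) (heat M e).
Proof.
rewrite /heat big_ord_recr /= /eqo addrAC subrr add0r.
by rewrite /divpow -scalerAl; apply: ordwZ; apply: ordw_tX.
Qed.

Lemma heat_init M e : eqo (wt o) 1 (heat M.+1 e) (divpow e P).
Proof.
rewrite /heat big_ord_recl /= divpow0 mul1r addn0 /eqo addrAC subrr add0r.
apply: ordw_sum => k _; rewrite /divpow -scalerAl; apply: ordwZ.
by apply: (@ordwS _ _ _ k.+1) => //; apply: ordw_tX.
Qed.

(* If Q solves the Hamilton-Jacobi equation with initial value P and
   Lambda Q = 0, then exp (Q / nu) solves the heat equation. *)
Lemma heat_powers Q k M : (k < M)%N -> eqo (wt o) 1 Q P ->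
  ordw (wt o) k (lam A Q) -> eqo (wt o) k Q^`M(o) (bil A Q Q) ->
  forall e, eqo (wt o) k.+1 (heat M e) (divpow e Q).
Proof.
case: M => [//|M]; rewrite ltnS => le_kM Q0 lamQ dQ.
have H0 e : eqo (wt o) 1 (heat M.+1 e) (divpow e Q).
  by apply: eqo_trans (heat_init _ _) _; apply: eqo_sym; apply: eqo_divpow.
suff S j : (j <= k)%N -> forall e, eqo (wt o) j.+1 (heat M.+1 e) (divpow e Q) by exact: S.
elim: j => [//|j IHj] lt_jk e.
apply: ordw_integral (H0 e) _; first by [].
rewrite mderivB mderiv_heat.
apply: (@eqo_trans _ _ _ _ (lam A (divpow e.+1 Q))).
  apply: eqo_lam; apply: eqo_trans _ (IHj (ltnW lt_jk) _).
  by apply: eqo_sym; apply: eqoS (heatS _ _); apply: leq_trans lt_jk le_kM.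
(* [lam_divpow] starts at exponent 2, so [e = 0] is separate: there Lambda Q = 0 must match the
   derivative of the constant 1. *)
case: e => [|e].
  by rewrite divpow1 divpow0 -mpolyC1 mderivC; apply: ordw_eqo0; exact: ordwS lt_jk lamQ.
rewrite lam_divpow mderiv_divpow -[X in eqo _ _ _ X]add0r; apply: eqoD.
  by apply: ordw_eqo0; apply: ordwMl; exact: ordwS lt_jk lamQ.
by apply: eqoM; [apply: eqo_refl | apply: eqo_sym; apply: eqoS lt_jk dQ].
Qed.

Definition lam_nilpotent := forall m, (1 <= m)%N -> iter m (lam A) (P ^+ m) = 0.

(** The term of index k becomes a multiple of Lambda^(k+1) (P^(k+1)). *)
Lemma lam_heat1 M : lam_nilpotent -> lam A (heat M 1) = 0.
Proof.
move=> nilP; rewrite /heat raddf_sum big1 // => k _ /=.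
rewrite lam_mul_const => [|i ne]; last exact: mderiv_divpow_t.
by rewrite -iterS /divpow iter_lamZ nilP // scaler0 mulr0.
Qed.

(** Induction on the order. The equation to order k shows, through [heat_powers], that the
    coefficient of nu^(-2) is Q^2 / 2 modulo t^(k+1); then the heat equation and Lambda Q = 0 give
    d_t Q = Lambda (Q^2 / 2) = <grad Q, A grad Q> to order k + 1. *)
Lemma heat1_hamilton_jacobi k M : (k < M)%N -> lam_nilpotent ->
  eqo (wt o) k (heat M 1)^`M(o) (bil A (heat M 1) (heat M 1)).
Proof.
case: M => [//|M]; rewrite ltnS => + nilP; set Q := heat M.+1 1.
have Q0 : eqo (wt o) 1 Q P by have := heat_init M 1; rewrite divpow1.
elim: k => [//|k IHk] lt_kM.
have lamQ : lam A Q = 0 by apply: lam_heat1.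
have H2 : eqo (wt o) k.+1 (heat M.+1 2) (divpow 2 Q).
  by apply: heat_powers; rewrite ?lamQ //; [exact: ltnW | apply: IHk; exact: ltnW].
rewrite mderiv_heat; apply: (@eqo_trans _ _ _ _ (lam A (divpow 2 Q))).
  apply: eqo_lam; apply: eqo_trans _ H2.
  by apply: eqo_sym; apply: eqoS (heatS _ _).
by rewrite lam_divpow divpow0 mul1r lamQ mulr0 add0r.
Qed.

End Series.
End SecondOrder.

(** * From the vanishing conjecture to polynomial inverses *)

Section Cotangent.
Context (K : numFieldType) (n : nat) (o : 'I_n).
Local Notation S := {mpoly K[n]}.
Local Notation S2 := {mpoly K[n + n]}.
Local Notation o2 := (lshift n o).
Local Notation t2 := ('X_o2 : S2).
Implicit Types (H N : 'I_n -> S) (p q : S).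

Definition lift2 (p : S) : S2 := p \at (fun i => 'X_(lshift n i)).

Definition proj2 (p : S2) : S :=
  p \at (glue (fun i => 'X_i) (fun=> 0)).

(* [lam pairing] is twice the sum of the D_(x_i) D_(y_i), where
   x_i = 'X_(lshift n i), y_i = 'X_(rshift n i) and i <> o. *)
Definition pairing : 'M[K]_(n + n) :=
  let E := \matrix_(i, j) ((i == j) && (i != o))%:R in block_mx 0 E E 0.

Lemma pairing_sym : pairing^T = pairing.
Proof.
rewrite /pairing tr_block_mx !trmx0; congr block_mx; apply/matrixP => i j;
by rewrite !mxE eq_sym; case: eqVneq => [->|].
Qed.

Lemma pairing_ol j : pairing o2 j = 0.
Proof.
rewrite /pairing; case: (split_ordP j) => k ->.
  by rewrite block_mxEul mxE.
by rewrite block_mxEur mxE eqxx andbF.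
Qed.

Lemma pairing_or i : pairing i o2 = 0.
Proof. by rewrite -pairing_sym mxE pairing_ol. Qed.

Lemma sum_pairing (F : 'I_(n + n) -> 'I_(n + n) -> S2) :
  \sum_i \sum_j pairing i j *: F i j =
  \sum_(i | i != o) (F (lshift n i) (rshift n i) + F (rshift n i) (lshift n i)).
Proof.
rewrite big_split_ord /= [RHS]big_split /=; congr (_ + _);
  rewrite [RHS]big_mkcond; apply: eq_bigr => i _;
  rewrite big_split_ord /=.
- rewrite big1 ?add0r => [|j _]; last by rewrite block_mxEul mxE scale0r.
  rewrite (bigD1 i) //= block_mxEur mxE eqxx big1 => [|j ne].
    by case: eqP => /= _; rewrite ?scale0r ?scale1r addr0.
  by rewrite block_mxEur mxE eq_sym (negPf ne) scale0r.
- rewrite [X in _ + X]big1 ?addr0 => [|j _]; last by rewrite block_mxEdr mxE scale0r.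
  rewrite (bigD1 i) //= block_mxEdl mxE eqxx big1 => [|j ne].
    by case: eqP => /= _; rewrite ?scale0r ?scale1r addr0.
  by rewrite block_mxEdl mxE eq_sym (negPf ne) scale0r.
Qed.

Lemma proj2_lift2 p : proj2 (lift2 p) = p.
Proof.
rewrite /proj2 /lift2 at_at -[RHS]at_id; apply: eq_at => i.
by rewrite atX glue_l.
Qed.

Lemma mderiv_lift2 p i : (lift2 p)^`M(lshift n i) = lift2 p^`M(i).
Proof.
rewrite /lift2 mderiv_at (bigD1 i) //= mderivXU eqxx mulr1 big1 ?addr0 // => j ne.
by rewrite mderivXU (inj_eq (@lshift_inj _ _)) (negPf ne) mulr0.
Qed.

Lemma mderiv_lift2_r p i : (lift2 p)^`M(rshift n i) = 0.
Proof.
by rewrite /lift2 mderiv_at big1 // => j _; rewrite mderivXU eq_lrshift mulr0.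
Qed.

Lemma ordw_lift2 k p : ordw (wt o) k p -> ordw (wt o2) k (lift2 p).
Proof.
apply: ordw_at => i; have := @ordwX K _ (wt o2) (lshift n i).
by rewrite /wt (inj_eq (@lshift_inj _ _)).
Qed.

Lemma eqo_lift2 k p q : eqo (wt o) k p q -> eqo (wt o2) k (lift2 p) (lift2 q).
Proof. by move=> /ordw_lift2; rewrite /lift2 comp_mpolyB. Qed.

Lemma eqo_proj2 k (p q : S2) : eqo (wt o2) k p q -> eqo (wt o) k (proj2 p) (proj2 q).
Proof.
apply: eqo_at_l => i; case: (split_ordP i) => j ->.
  by rewrite glue_l /wt (inj_eq (@lshift_inj _ _)); apply: ordwX.
by rewrite glue_r.
Qed.

(** The factor 1/2 cancels the two equal terms that each pair of variables contributes to a sum over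
    [pairing]. *)
Definition hamiltonian N : S2 := (2^-1 : K) *: \sum_i 'X_(rshift n i) * lift2 (N i).

Lemma mderiv_hamiltonian_r N j :
  (hamiltonian N)^`M(rshift n j) = (2^-1 : K) *: lift2 (N j).
Proof.
rewrite /hamiltonian mderivZ; congr (_ *: _).
rewrite raddf_sum /= (bigD1 j) //= mderivM mderivXU eqxx.
rewrite mderiv_lift2_r mul1r mulr0 addr0 big1 ?addr0 // => i ne.
rewrite mderivM mderivXU (inj_eq (@rshift_inj _ _)) (negPf ne).
by rewrite mderiv_lift2_r mul0r mulr0 addr0.
Qed.

Lemma mderiv_hamiltonian_l N j :
  (hamiltonian N)^`M(lshift n j) = hamiltonian (fun i => (N i)^`M(j)).
Proof.
rewrite /hamiltonian mderivZ; congr (_ *: _); rewrite raddf_sum; apply: eq_bigr => i _ /=.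
by rewrite mderivM mderivXU eq_rlshift mul0r add0r mderiv_lift2.
Qed.

Lemma eqo_hamiltonian k H N : (forall i, eqo (wt o) k (H i) (N i)) ->
  eqo (wt o2) k (hamiltonian H) (hamiltonian N).
Proof.
move=> HN; apply: eqoZ; apply: eqo_sum => i _; apply: eqoM => //.
exact: eqo_lift2.
Qed.

Lemma lam_hamiltonian N : lam pairing (hamiltonian N) = lift2 (rdiv o N).
Proof.
rewrite /lam sum_pairing /rdiv /lift2 raddf_sum; apply: eq_bigr => i ne.
rewrite [X in X + _]mderiv_comm -mulr2n mderiv_hamiltonian_l mderiv_hamiltonian_r.
by rewrite -scaler_nat scalerA divff ?scale1r ?pnatr_eq0 //.
Qed.

(** Hence the Hamilton-Jacobi equation for <y, N> / 2 is the Burgers equation for N. *)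
Lemma bil_hamiltonian N : N o = 0 ->
  bil pairing (hamiltonian N) (hamiltonian N) = hamiltonian (advect N).
Proof.
move=> No; rewrite /bil sum_pairing.
transitivity (\sum_i (hamiltonian (fun l => (N l)^`M(i)) * lift2 (N i))).
  rewrite [RHS](bigD1 o) //= No /lift2 comp_mpoly0 mulr0 add0r; apply: eq_bigr => i _.
  rewrite [X in X + _]mulrC -mulr2n mderiv_hamiltonian_l mderiv_hamiltonian_r.
  by rewrite -scalerAr -scaler_nat scalerA divff ?scale1r ?pnatr_eq0 //.
rewrite /hamiltonian; under eq_bigr => i _ do rewrite -scalerAl.
rewrite -scaler_sumr; congr (_ *: _).
under eq_bigr => i _ do rewrite mulr_suml.
rewrite exchange_big; apply: eq_bigr => l _ /=.
rewrite /advect /lift2 raddf_sum mulr_sumr; apply: eq_bigr => i _ /=.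
by rewrite rmorphM /= mulrA.
Qed.

(** As [rjac] is constant, [mderiv_rjac] makes div N vanish after the substitution z - t H;
    substituting the inverse z + t N undoes it. *)
Lemma rdiv_fixpoint H N k : H o = 0 -> N o = 0 -> (forall i, (H i)^`M(o) = 0) ->
  rjac o H = 1 -> (forall i, eqo (wt o) k (N i) (H i \at (bwd o N))) ->
  ordw (wt o) k (rdiv o N).
Proof.
move=> Ho No dH J1 HN.
have := mderiv_rjac Ho dH HN; rewrite J1 mulr1 -mpolyC1 mderivC => /eqoN.
rewrite oppr0 opprK => /eqo_sym E.
have {E} := eqo_at_l (fun i => ordw_bwd i No) E.
rewrite comp_mpoly0 at_at => E; have {E} : eqo (wt o) k (rdiv o N) 0.
  apply: eqo_trans _ E; apply: eqo_sym; rewrite -[X in eqo _ _ _ X]at_id.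
  by apply: eqo_at => i; apply: (eqoS (leqnSn k)); apply: fixpoint_bwd.
by rewrite /eqo subr0.
Qed.

Lemma fixpoint_init H N k : (forall i, eqo (wt o) k.+1 (N i) (H i \at (bwd o N))) ->
  forall i, eqo (wt o) 1 (N i) (H i).
Proof.
move=> HN i; apply: eqo_trans (eqoS (ltn0Sn k) (HN i)) _.
rewrite -[X in eqo _ _ _ X]at_id; apply: eqo_at => l.
by rewrite /bwd /eqo addrAC subrr add0r; apply: ordw_t.
Qed.

(** The three conditions of [heat_powers] on Q = <y, N> / 2 are the initial value of N, div N = 0
    and the Burgers equation. *)
Lemma heat_hamiltonian H N k : H o = 0 -> N o = 0 -> (forall i, (H i)^`M(o) = 0) ->
  rjac o H = 1 -> (forall i, eqo (wt o) k.+1 (N i) (H i \at (bwd o N))) ->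
  forall e, eqo (wt o2) k.+1 (heat o2 pairing (hamiltonian H) k.+1 e)
    (divpow e (hamiltonian N)).
Proof.
move=> Ho No dH J1 HN; apply: heat_powers => //.
- exact: pairing_ol.
- exact: pairing_or.
- rewrite mderiv_hamiltonian_l /hamiltonian big1 ?scaler0 // => i _.
  by rewrite dH /lift2 comp_mpoly0 mulr0.
- by apply: eqo_hamiltonian; apply: fixpoint_init HN.
- rewrite lam_hamiltonian; apply: ordw_lift2; apply: ordwS (leqnSn k) _.
  exact: rdiv_fixpoint HN.
- rewrite mderiv_hamiltonian_l bil_hamiltonian //; apply: eqo_hamiltonian.
  exact: fixpoint_burgers.
Qed.

Lemma flow_inverse H : H o = 0 -> (forall i, (H i)^`M(o) = 0) -> rjac o H = 1 ->
  (forall P, lam_nilpotent pairing P ->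
     exists k0, forall m, (k0 <= m)%N -> iter m (lam pairing) (P ^+ m.+1) = 0) ->
  exists g : 'I_n -> S, forall i, g i \at (fwd o H) = 'X_i.
Proof.
move=> Ho dH J1 VCn; pose P := hamiltonian H.
have dP : P^`M(o2) = 0.
  rewrite mderiv_hamiltonian_l /hamiltonian big1 ?scaler0 // => i _.
  by rewrite dH /lift2 comp_mpoly0 mulr0.
have nilP : lam_nilpotent pairing P.
  move=> m m_gt0; have [N [No HN]] := fixpoint_ex m.+1 Ho.
  (* At exponent 0 the right side is the constant 1, so the terms of positive index in [heat]
     vanish; up to factorials they are t^k Lambda^k (P^k). *)
  have := heat_hamiltonian Ho No dH J1 HN 0.
  rewrite /heat /eqo big_ord_recl /= !divpow0 mul1r addrAC subrr add0r => E.
  pose f k := if k == 0%N then 0 else (k`!)%:R^-1 *: iter k (lam pairing) (divpow k P).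
  have ordf : ordw (wt o2) m.+1 (\sum_(k < m.+1) t2 ^+ k * f k).
    rewrite big_ord_recl /= mulr0 add0r.
    rewrite [X in ordw _ _ X](_ : _ = \sum_(i < m) divpow (bump 0 i) t2 *
      iter (bump 0 i) (lam pairing) (divpow (0 + bump 0 i) P)) //.
    by apply: eq_bigr => i _; rewrite /f /= /divpow -scalerAl scalerAr.
  have df k : (f k)^`M(o2) = 0.
    by rewrite /f; case: eqP => _; rewrite ?mderiv0 // mderivZ mderiv_iter_lam ?scaler0.
  have := series_eq0 df ordf (ltnSn m).
  rewrite /f (gtn_eqF m_gt0) /divpow iter_lamZ scalerA => /eqP.
  rewrite scaler_eq0 mulf_eq0 invr_eq0.
  by rewrite !pnatr_eq0 gtn_eqF ?fact_gt0 //= => /eqP.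
have [k0 vanP] := VCn P nilP.
(* The terms of Q from index [k0] on vanish, so the truncation [V] is all of Q. *)
pose V := heat o2 pairing P k0 1.
have heatV k : (k0 <= k)%N -> heat o2 pairing P k 1 = V.
  move=> /subnKC <-; rewrite /V /heat big_split_ord /= [X in _ + X]big1 ?addr0 // => i _.
  by rewrite /divpow iter_lamZ add1n vanP ?leq_addr // scaler0 mulr0.
(* N is twice the y-gradient of Q = <y, N> / 2; [proj2] returns to the variables x. *)
pose v i := 2 *: proj2 V^`M(rshift n i).
have vE i : v i \at (fwd o H) = H i.
  (* Modulo each power of t, [v] may be replaced by an approximate fixpoint N; agreement modulo all
     of them is equality. *)
  apply: (@eqo_eq _ _ (wt o)) => k.
  have [N [No HN]] := fixpoint_ex (k0 + k).+1 Ho.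
  have := heat_hamiltonian Ho No dH J1 HN 1.
  rewrite heatV ?leqW ?leq_addr // divpow1 => E.
  have {E} : eqo (wt o) (k0 + k).+1 (v i) (N i).
    have -> : N i = 2 *: proj2 (hamiltonian N)^`M(rshift n i).
      rewrite mderiv_hamiltonian_r /proj2 comp_mpolyZ -/(proj2 _) proj2_lift2.
      by rewrite scalerA divff ?scale1r // pnatr_eq0.
    by apply: eqoZ; apply: eqo_proj2; apply: eqo_mderiv E; rewrite /wt eq_rlshift.
  move=> /(eqo_at_l (fun i => ordw_fwd i Ho)) E.
  apply: (@eqoS _ _ _ (k0 + k).+1); first by rewrite leqW // leq_addl.
  by apply: eqo_trans E _; apply: fixpoint_fwd.
exists (bwd o v) => i; rewrite /bwd comp_mpolyD rmorphM /= t_fwd // vE atX.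
by rewrite /fwd subrK.
Qed.

End Cotangent.

(** Column elimination with the identity block leaves the Schur complement. *)
Lemma det_block_dr1 (R : comNzRingType) (m n : nat) (A : 'M[R]_m) B C :
  \det (block_mx A B C (1%:M : 'M_n)) = \det (A - B *m C).
Proof.
have detL : \det (block_mx 1%:M 0 (- C) 1%:M : 'M_(m + n)) = 1.
  by rewrite det_lblock !det1 mulr1.
transitivity (\det (block_mx A B C 1%:M) * \det (block_mx 1%:M 0 (- C) 1%:M : 'M_(m + n))).
  by rewrite detL mulr1.
rewrite -det_mulmx mulmx_block !mulmx1 !mulmx0 mul1mx !add0r subrr.
by rewrite det_ublock det1 mulr1 mulmxN.
Qed.

(** * Lowering the degree in t by adjoining variables *)

Section Chain.
Context (K : numFieldType).

Definition lam_vanishing (n : nat) (A : 'M[K]_n) (P : {mpoly K[n]}) :=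
  exists k0, forall m, (k0 <= m)%N -> iter m (lam A) (P ^+ m.+1) = 0.

Definition VC_quadratic := forall n : nat, (1 <= n)%N -> forall A : 'M[K]_n,
  A^T = A -> forall P, lam_nilpotent A P -> lam_vanishing A P.

Lemma eq_rjac (n : nat) (o : 'I_n) (H N : 'I_n -> {mpoly K[n]}) :
  H =1 N -> rjac o H = rjac o N.
Proof.
by move=> HN; congr (\det (_ - _ *: _)); apply/matrixP => i j; rewrite !mxE HN.
Qed.

Section Step.
Context (n : nat) (o : 'I_n) (H0 Hp : 'I_n -> {mpoly K[n]}).
Local Notation S := {mpoly K[n]}.
Local Notation S2 := {mpoly K[n + n]}.
Local Notation o2 := (lshift n o).
Local Notation t := ('X_o : S).
Local Notation t2 := ('X_o2 : S2).
Hypotheses (H0o : H0 o = 0) (Hpo : Hp o = 0).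

(* The map (x, v) |-> (x - t (H0 x + v), v - t Hp x), whose inverse yields that
   of x |-> x - t (H0 x + t Hp x) by restriction to v = t Hp x. *)
Definition unfolding : 'I_(n + n) -> S2 :=
  glue (fun i => lift2 (H0 i) + (if i == o then 0 else 'X_(rshift n i)))
       (fun i => lift2 (Hp i)).

Lemma rJ_unfolding (E := \matrix_(i, j) ((i == j) && (i != o))%:R : 'M[S2]_n) :
  rJ o2 unfolding =
  block_mx (map_mx (@lift2 K n) (rJ o H0)) E (map_mx (@lift2 K n) (rJ o Hp)) 0.
Proof.
apply/matrixP => a b; case: (split_ordP a) => i ->; case: (split_ordP b) => j ->;
  rewrite ?(block_mxEul, block_mxEur, block_mxEdl, block_mxEdr) !mxE /unfolding
    ?glue_l ?glue_r ?eq_rlshift ?(inj_eq (@lshift_inj _ _)).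
- case: eqVneq => _; first by rewrite /lift2 comp_mpoly0.
  rewrite mderivD mderiv_lift2; case: eqVneq => _; first by rewrite mderiv0 addr0.
  by rewrite mderivXU eq_rlshift addr0.
- rewrite mderivD mderiv_lift2_r add0r; case: eqVneq => _; first by rewrite mderiv0 andbF.
  by rewrite mderivXU (inj_eq (@rshift_inj _ _)) andbT.
- by case: eqVneq => _; rewrite ?mderiv_lift2 // /lift2 comp_mpoly0.
- by rewrite mderiv_lift2_r.
Qed.

(** Eliminating the v-block leaves 1 - t JH0 - t^2 E JHp, and [E] fixes JHp because the row [o] of
    JHp is zero. *)
Lemma rjac_unfolding :
  rjac o2 unfolding = lift2 (rjac o (fun i => H0 i + t * Hp i)).
Proof.
rewrite /rjac rJ_unfolding; set E := \matrix_(i, j) _.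
set JA := map_mx _ _; set JB := map_mx _ _.
have EB : E *m JB = JB.
  apply/matrixP => i j; rewrite !mxE (bigD1 i) //= !mxE eqxx big1 => [|k ne].
    rewrite addr0; case: (eqVneq i o) => [->|_]; last by rewrite mul1r.
    by rewrite mul0r Hpo mderiv0; case: eqP => _; rewrite /lift2 comp_mpoly0.
  by rewrite !mxE eq_sym (negPf ne) mul0r.
rewrite [X in \det X](_ : _ =
    block_mx (1%:M - t2 *: JA) (- (t2 *: E)) (- (t2 *: JB)) 1%:M); last first.
  rewrite scalar_mx_block scale_block_mx opp_block_mx add_block_mx.
  by congr block_mx; rewrite ?scaler0 ?oppr0 ?addr0 ?add0r.
rewrite det_block_dr1. rewrite mulNmx mulmxN opprK. rewrite -scalemxAl -scalemxAr EB.
rewrite /lift2 -(det_map_mx (comp_mpoly _)); congr (\det _).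
apply/matrixP => i j; rewrite !mxE.
transitivity (lift2 ((i == j)%:R - t * (if j == o then 0 else
    (H0 i + t * Hp i)^`M(j)))); last by [].
rewrite /lift2 comp_mpolyB rmorphM /= atX rmorph_nat.
case: (eqVneq j o) => [_|ne]; first by rewrite !comp_mpoly0 !mulr0 !subr0.
rewrite mderivD mderivM mderivXU [o == j]eq_sym (negPf ne) mul0r add0r.
by rewrite comp_mpolyD rmorphM /= atX; ring.
Qed.

(** The point (x, t Hp(x)) is sent to (x - t (H0 + t Hp), 0), so the required inverse is the x-part
    of [g] at v = 0; [r] below parametrizes the graph v = t Hp(x). *)
Lemma unfolding_inverse (g : 'I_(n + n) -> S2) :
  (forall i, g i \at (fwd o2 unfolding) = 'X_i) ->
  exists h : 'I_n -> S,
    forall i, h i \at (fwd o (fun i => H0 i + t * Hp i)) = 'X_i.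
Proof.
move=> Hg; exists (fun i => proj2 (g (lshift n i))) => i.
pose v i : S := if i == o then 0 else t * Hp i.
pose r := glue (fun i => 'X_i) (fun i => t * Hp i) : 'I_(n + n) -> S.
have rl p : lift2 p \at r = p.
  rewrite /lift2 at_at -[RHS]at_id; apply: eq_at => j.
  by rewrite atX /r glue_l.
transitivity (g (lshift n i) \at (fwd o2 unfolding) \at r); last first.
  by rewrite Hg atX /r glue_l.
rewrite /proj2 !at_at; apply: eq_at => j; case: (split_ordP j) => l ->.
  rewrite glue_l atX /fwd /unfolding glue_l comp_mpolyB rmorphM /= comp_mpolyD rl.
  rewrite !atX /r !glue_l; congr (_ - _ * (_ + _)).
  by case: eqVneq => [->|_]; rewrite ?Hpo ?mulr0 ?comp_mpoly0 // atX glue_r.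
rewrite glue_r comp_mpoly0 /fwd /unfolding glue_r comp_mpolyB rmorphM /= rl.
by rewrite !atX /r glue_r glue_l subrr.
Qed.

End Step.

Definition tseries (n : nat) (o : 'I_n) D (H : nat -> 'I_n -> {mpoly K[n]}) i :=
  \sum_(j < D) 'X_o ^+ j * H j i.

Lemma tseriesS n (o : 'I_n) D (H : nat -> 'I_n -> {mpoly K[n]}) i :
  tseries o D.+1 H i = H 0%N i + 'X_o * tseries o D (fun j => H j.+1) i.
Proof.
rewrite /tseries big_ord_recl mul1r; congr (_ + _).
by rewrite mulr_sumr; apply: eq_bigr => j _; rewrite mulrA -exprS.
Qed.

(** Induction on the degree in t. Degree 0 is [flow_inverse]; each unfolding doubles the number of
    variables, lowers the degree by one and keeps the determinant equal to 1. *)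
Lemma tseries_inverse D (n : nat) (o : 'I_n) (H : nat -> 'I_n -> {mpoly K[n]}) :
  VC_quadratic -> (forall j, H j o = 0) -> (forall j i, (H j i)^`M(o) = 0) ->
  rjac o (tseries o D.+1 H) = 1 ->
  exists g : 'I_n -> {mpoly K[n]}, forall i, g i \at (fwd o (tseries o D.+1 H)) = 'X_i.
Proof.
move=> VCq; elim: D n o H => [|D IHD] n o H Ho dH J1.
  have HE : tseries o 1 H =1 H 0%N.
    by move=> i; rewrite tseriesS /tseries big_ord0 mulr0 addr0.
  have [||||g Hg] := @flow_inverse K n o (H 0%N).
  - exact: Ho.
  - exact: dH.
  - by rewrite -J1; apply: eq_rjac => i; rewrite HE.
  - move=> P; apply: VCq; last exact: pairing_sym.
    by rewrite addn_gt0 (leq_ltn_trans _ (ltn_ord o)).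
  - by exists g => i; rewrite -(Hg i); apply: eq_at => l; rewrite /fwd HE.
set Hp := tseries o D.+1 (fun j => H j.+1).
have HE : tseries o D.+2 H =1 (fun i => H 0%N i + 'X_o * Hp i) by move=> i; exact: tseriesS.
have Hpo : Hp o = 0 by rewrite /Hp /tseries big1 // => j _; rewrite Ho mulr0.
(* Coefficients of the unfolded map: the x-block lives in t^0 only, and the v-block carries those of
   [Hp], hence the index shift. *)
pose Hn j : 'I_(n + n) -> {mpoly K[n + n]} :=
  glue (fun i => if j == 0%N then lift2 (H 0%N i) + (if i == o then 0 else 'X_(rshift n i)) else 0)
       (fun i => lift2 (H j.+1 i)).
have HnE : tseries (lshift n o) D.+1 Hn =1 unfolding o (H 0%N) Hp.
  move=> a; case: (split_ordP a) => i ->; rewrite /unfolding ?glue_l ?glue_r.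
    rewrite tseriesS /tseries big1 ?mulr0 ?addr0 ?/Hn ?glue_l // => j _.
    by rewrite glue_l mulr0.
  rewrite /Hp /tseries /lift2 raddf_sum; apply: eq_bigr => j _ /=.
  by rewrite /Hn glue_r rmorphM rmorphXn /= atX.
have [||| g Hg] := IHD _ (lshift n o) Hn.
- by move=> j; rewrite /Hn glue_l eqxx addr0 Ho /lift2 comp_mpoly0; case: eqP.
- move=> j a; case: (split_ordP a) => i ->; rewrite /Hn ?glue_l ?glue_r.
    case: eqP => _; last by rewrite mderiv0.
    rewrite mderivD mderiv_lift2 dH /lift2 comp_mpoly0 add0r.
    by case: eqP => _; rewrite ?mderiv0 // mderivXU eq_rlshift.
  by rewrite mderiv_lift2 dH /lift2 comp_mpoly0.
- rewrite (eq_rjac _ HnE) rjac_unfolding // -(eq_rjac _ HE) J1.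
  by rewrite /lift2 comp_mpoly1.
have [|h Hh] := @unfolding_inverse n o (H 0%N) Hp Hpo g.
  by move=> i; rewrite -(Hg i); apply: eq_at => l; rewrite /fwd HnE.
by exists h => i; rewrite -(Hh i); apply: eq_at => l; rewrite /fwd HE.
Qed.

End Chain.

(** * Inverting arbitrary maps with Jacobian determinant 1 *)

Section Keller.
Context (K : numFieldType).

Lemma homog_at_scale (n l : nat) (p : {mpoly K[n]}) d (u : {mpoly K[l]})
    (g : 'I_n -> {mpoly K[l]}) :
  p \is d.-homog -> p \at (fun i => u * g i) = u ^+ d * (p \at g).
Proof.
move=> /dhomogP Hp; rewrite !comp_mpolyE mulr_sumr [LHS]big_seq [RHS]big_seq.
apply: eq_bigr => m pm; rewrite -scalerAr; congr (_ *: _).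
have -> : d = (\sum_i m i)%N by rewrite -mdegE -(Hp _ pm).
rewrite -prodrXr -big_split; apply: eq_bigr => i _ /=.
by rewrite !tnth_mktuple exprMn.
Qed.

(** H has no terms of degree below 2, so T = H(t x) / t^2 is polynomial, and x - t T = (t x - H(t
    x)) / t is the given map rescaled. Its Jacobian determinant is that of x - H at t x, hence 1.
    The inverse is found with t as a parameter, and then t is set to 1. *)
Lemma keller_normalized (n : nat) (H : 'I_n -> {mpoly K[n]}) :
  VC_quadratic K -> (forall i, ordw (fun=> 1%N) 2 (H i)) ->
  \det (\matrix_(i < n, j < n) ('X_i - H i)^`M(j)) = 1 ->
  exists g : 'I_n -> {mpoly K[n]}, forall i, g i \at (fun i => 'X_i - H i) = 'X_i.
Proof.
move=> VCq H2 J1; pose o := lshift n (ord0 : 'I_1).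
pose t := 'X_o : {mpoly K[1 + n]}.
pose tx (l : 'I_n) := t * 'X_(rshift 1 l).
pose up (p : {mpoly K[n]}) : {mpoly K[1 + n]} := p \at (fun i => 'X_(rshift 1 i)).
pose D := \max_i msize (H i).
pose Hs j := glue (fun _ : 'I_1 => 0) (fun i => up (pihomog mdeg j.+2 (H i))).
set T := tseries o D.+1 Hs.
have Tl a : T (lshift n a) = 0.
  by rewrite /T /tseries big1 // => j _; rewrite /Hs glue_l mulr0.
have low d i : (d < 2)%N -> pihomog mdeg d (H i) = 0.
  move=> lt_d; rewrite pihomogE big_seq_cond big1 // => m /andP[_ /eqP md].
  by rewrite (ordwP (H2 i)) ?scale0r // mweight_by1 md.
have tT i : t ^+ 2 * T (rshift 1 i) = H i \at tx.
  have leD : (msize (H i) <= D.+3)%N.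
    by rewrite -addn3; apply: leq_trans (leq_addr _ _); apply: leq_bigmax.
  rewrite [in RHS](pihomog_partitionE leD) raddf_sum /= 2!big_ord_recl !low //.
  rewrite !comp_mpoly0 !add0r /T /tseries mulr_sumr; apply: eq_bigr => j _ /=.
  rewrite (homog_at_scale _ _ (pihomogP mdeg _ _)) mulrA -exprD add2n.
  by rewrite /Hs glue_r.
have dT i k : t * (T (rshift 1 i))^`M(rshift 1 k) = (H i)^`M(k) \at tx.
  have t0 : t != 0 by rewrite -msize_poly_eq0 msizeX mdeg1.
  apply: (mulfI t0).
  have dt : t^`M(rshift 1 k) = 0 by rewrite mderivXU eq_lrshift.
  transitivity ((t ^+ 2 * T (rshift 1 i))^`M(rshift 1 k)).
    by rewrite expr2 !mderivM dt mul0r mulr0 addr0 mul0r add0r mulrA.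
  rewrite tT mderiv_at (bigD1 k) //= big1 => [|l ne].
    by rewrite mderivM dt mderivXU eqxx mulr1 mul0r add0r addr0 mulrC.
  by rewrite mderivM dt mderivXU (inj_eq (@rshift_inj _ _)) (negPf ne) mul0r mulr0 addr0 mulr0.
have JT : rjac o T = 1.
  rewrite /rjac [X in \det X](_ : _ = block_mx 1%:M 0 0
     (map_mx (comp_mpoly [tuple tx l | l < n]) (\matrix_(i < n, j < n) ('X_i - H i)^`M(j)))).
    by rewrite det_ublock det1 mul1r det_map_mx J1 rmorph1.
  apply/matrixP => a b; case: (split_ordP a) => i ->; case: (split_ordP b) => j ->;
    rewrite ?(block_mxEul, block_mxEur, block_mxEdl, block_mxEdr) !mxE
      ?eq_lrshift ?eq_rlshift ?(inj_eq (@lshift_inj _ _)) ?(inj_eq (@rshift_inj _ _)).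
  - by rewrite (ord1 j) eqxx mulr0 subr0.
  - by rewrite Tl mderiv0 mulr0 subr0.
  - by rewrite (ord1 j) eqxx mulr0 subr0.
  - by rewrite dT mderivB mderivXU comp_mpolyB rmorph_nat.
have [||g Hg] := tseries_inverse VCq _ _ JT.
- by move=> j; rewrite /Hs glue_l.
- move=> j a; case: (split_ordP a) => i ->; rewrite /Hs ?glue_l ?glue_r ?mderiv0 //.
  by rewrite /up mderiv_at big1 // => l _; rewrite mderivXU eq_rlshift mulr0.
pose s := glue (fun _ : 'I_1 => 1) (fun i => 'X_i) : 'I_(1 + n) -> {mpoly K[n]}.
have st : t \at s = 1 by rewrite atX /s glue_l.
exists (fun i => g (rshift 1 i) \at s) => i.
transitivity (g (rshift 1 i) \at (fwd o T) \at s); last first.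
  by rewrite Hg atX /s glue_r.
rewrite !at_at; apply: eq_at => b; case: (split_ordP b) => l ->.
  by rewrite /fwd Tl mulr0 subr0 atX /s glue_l comp_mpoly1.
rewrite /fwd comp_mpolyB rmorphM /= st mul1r !atX /s glue_r atX; congr (_ - _).
have := congr1 (comp_mpoly [tuple s i | i < 1 + n]) (tT l).
rewrite rmorphM rmorphXn /= st expr1n mul1r => ->.
rewrite at_at -[LHS]at_id; apply: eq_at => k.
by rewrite /tx rmorphM /= st mul1r atX /s glue_r.
Qed.

(** The Jacobian matrix [B] at 0 has determinant 1; composing with its inverse makes the linear part
    the identity. *)
Lemma keller_left_inverse (n : nat) (F : 'I_n -> {mpoly K[n]}) :
  VC_quadratic K -> \det (\matrix_(i < n, j < n) (F i)^`M(j)) = 1 ->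
  exists g : 'I_n -> {mpoly K[n]},
    forall i, g i \at (fun i => F i - ((F i)@_0%MM)%:MP) = 'X_i.
Proof.
move=> VCq J1; pose Fc i := F i - ((F i)@_0%MM)%:MP.
pose B : 'M[K]_n := \matrix_(i, j) (F i)@_U_(j)%MM.
have detB : \det B = 1.
  have -> : B = map_mx (@mcoeff n K 0%MM) (\matrix_(i < n, j < n) (F i)^`M(j)).
    by apply/matrixP => i j; rewrite !mxE mcoeff_mderiv add0m mnm0E.
  by rewrite det_map_mx J1 rmorph1.
have BV : invmx B *m B = 1%:M by rewrite mulVmx // unitmxE detB unitr1.
pose L i := \sum_l invmx B i l *: Fc l.
pose H i := 'X_i - L i.
have XH i : 'X_i - H i = L i by rewrite /H opprB addrC subrK.
have H2 i : ordw (fun=> 1%N) 2 (H i).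
  apply/ordwP => m; rewrite mweight_by1 ltnS leq_eqVlt ltnS leqn0 /H mcoeffB raddf_sum /=.
  move=> /orP[/mdeg1P[k /eqP ->]|].
    rewrite mcoeffXU; apply/eqP; rewrite subr_eq0; apply/eqP.
    transitivity ((invmx B *m B) i k); first by rewrite BV mxE.
    rewrite mxE; apply: eq_bigr => l _; rewrite mcoeffZ mxE mcoeffB mcoeffC.
    by rewrite mnm1_eq0 mulr0 subr0.
  rewrite mdeg_eq0 => /eqP ->; rewrite mcoeffX mnm1_eq0 sub0r big1 ?oppr0 // => l _.
  by rewrite mcoeffZ mcoeffB mcoeffC eqxx mulr1 subrr mulr0.
have [|g Hg] := keller_normalized VCq H2.
  under eq_mx => i j do rewrite XH.
  have -> : \matrix_(i < n, j < n) (L i)^`M(j) =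
     map_mx (@mpolyC n K) (invmx B) *m (\matrix_(i < n, j < n) (F i)^`M(j)).
    apply/matrixP => i j; rewrite !mxE /L raddf_sum; apply: eq_bigr => l _ /=.
    by rewrite !mxE mderivZ mderivB mderivC subr0 mul_mpolyC.
  by rewrite det_mulmx J1 det_map_mx det_inv detB invr1 mulr1 rmorph1.
(* The inverse of B^(-1) (F - F(0)), precomposed with B^(-1), inverts F - F(0). *)
exists (fun i => g i \at (fun i => \sum_l invmx B i l *: 'X_l)) => i.
rewrite at_at -(Hg i); apply: eq_at => k; rewrite XH /L raddf_sum; apply: eq_bigr => l _ /=.
by rewrite comp_mpolyZ atX.
Qed.

End Keller.

(** * From the Jacobian conjecture to the vanishing conjecture *)

Lemma det_row_delta (R : comNzRingType) (n : nat) (o : 'I_n) (X : 'M[R]_n) :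
  (forall j, X o j = (o == j)%:R) -> \det X = cofactor X o o.
Proof.
move=> rowX; rewrite (expand_det_row X o) (bigD1 o) //= rowX eqxx mul1r.
by rewrite big1 ?addr0 // => j ne; rewrite rowX eq_sym (negPf ne) mul0r.
Qed.

Section Gradient.
Context (K : numFieldType) (n : nat) (o : 'I_n) (A : 'M[K]_n).
Hypotheses (At : A^T = A) (Aol : forall j, A o j = 0).
Local Notation S := {mpoly K[n]}.
Local Notation t := ('X_o : S).
Implicit Types (p q P : S).

(** The factor 2 is the one for which 2 A grad Q solves the Burgers equation when Q solves the
    Hamilton-Jacobi equation. *)
Definition agrad p i : S := 2 *: \sum_j A i j *: p^`M(j).

Let Aor i : A i o = 0.
Proof. by rewrite -At mxE Aol. Qed.

Lemma agrad_o p : agrad p o = 0.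
Proof. by rewrite /agrad big1 ?scaler0 // => j _; rewrite Aol scale0r. Qed.

Lemma eqo_agrad k p q i : eqo (wt o) k p q -> eqo (wt o) k (agrad p i) (agrad q i).
Proof.
move=> pq; apply: eqoZ; apply: eqo_sum => j _.
case: (eqVneq j o) => [->|ne]; first by rewrite Aor !scale0r.
by apply: eqoZ; apply: eqo_mderiv pq; rewrite wt_other.
Qed.

Lemma mderiv_agrad p i j : (agrad p i)^`M(j) = agrad p^`M(j) i.
Proof.
rewrite /agrad mderivZ; congr (_ *: _); rewrite raddf_sum; apply: eq_bigr => l _ /=.
by rewrite mderivZ mderiv_comm.
Qed.

Lemma bil_agrad p q : bil A p q = 2^-1 *: \sum_i agrad p i * q^`M(i).
Proof.
rewrite scaler_sumr; apply: eq_bigr => i _.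
rewrite /agrad -scalerAl scalerA mulVf ?pnatr_eq0 // scale1r mulr_suml.
by apply: eq_bigr => j _; rewrite scalerAl.
Qed.

Lemma mderiv_bil p j : (bil A p p)^`M(j) = \sum_i agrad p i * p^`M(j)^`M(i).
Proof.
have D q : bil A q^`M(j) q + bil A q q^`M(j) = (bil A q q)^`M(j).
  rewrite /bil -big_split [RHS]raddf_sum; apply: eq_bigr => i _ /=.
  rewrite -big_split [RHS]raddf_sum; apply: eq_bigr => l _ /=.
  rewrite mderivZ mderivM -scalerDr mderiv_comm.
  by congr (_ *: (_ + _ * _)); apply: mderiv_comm.
rewrite -D bilC // bil_agrad -mulr2n -scaler_nat scalerA divff ?pnatr_eq0 //.
by rewrite scale1r.
Qed.

(** By symmetry of A and of second derivatives, the gradient of the Hamilton-Jacobi equation is the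
    Burgers equation. *)
Lemma agrad_bil p i : agrad (bil A p p) i = advect (agrad p) i.
Proof.
rewrite /advect {1}/agrad.
under eq_bigr => j _ do rewrite mderiv_bil scaler_sumr.
rewrite exchange_big scaler_sumr; apply: eq_bigr => l _ /=.
rewrite mderiv_agrad [agrad p^`M(l) i]/agrad -scalerAl; congr (_ *: _).
rewrite mulr_suml; apply: eq_bigr => j _; rewrite -[RHS]scalerAl mulrC.
by congr (_ *: (_ * _)); apply: mderiv_comm.
Qed.

Lemma rdiv_agrad p : rdiv o (agrad p) = 2 *: lam A p.
Proof.
rewrite /rdiv /lam scaler_sumr [RHS](bigD1 o) //= [X in 2 *: X + _]big1 => [|j _].
  rewrite scaler0 add0r.
  apply: eq_bigr => i ne; rewrite /agrad mderivZ; congr (_ *: _).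
  by rewrite raddf_sum; apply: eq_bigr => j _; rewrite /= mderivZ.
by rewrite Aol scale0r.
Qed.

Lemma agrad_mul_const (u p : S) i : (forall j, j != o -> u^`M(j) = 0) ->
  agrad (u * p) i = u * agrad p i.
Proof.
move=> du; rewrite /agrad -scalerAr; congr (_ *: _).
rewrite mulr_sumr; apply: eq_bigr => j _.
case: (eqVneq j o) => [->|ne]; first by rewrite Aor !scale0r mulr0.
by rewrite mderivM du // mul0r add0r scalerAr.
Qed.

Lemma agrad_sum (I : finType) (F : I -> S) i :
  agrad (\sum_k F k) i = \sum_k agrad (F k) i.
Proof.
rewrite /agrad -scaler_sumr exchange_big; congr (_ *: _); apply: eq_bigr => j _ /=.
by rewrite (raddf_sum (mderiv j)) scaler_sumr.
Qed.

Lemma agradZ c p i : agrad (c *: p) i = c *: agrad p i.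
Proof.
rewrite /agrad !scaler_sumr; apply: eq_bigr => j _.
by rewrite mderivZ !scalerA; congr (_ *: _); ring.
Qed.

Lemma heat_leq P M L e : (M <= L)%N ->
  eqo (wt o) M (heat o A P M e) (heat o A P L e).
Proof.
move=> /subnKC <-; elim: (L - M)%N => [|l IHl]; first by rewrite addn0.
apply: eqo_trans IHl _; apply: eqo_sym; rewrite addnS.
exact: eqoS (leq_addr _ _) (heatS _ _ _ _ _).
Qed.

(** The two matrices differ only in column [o], which holds t-derivatives on the left; row [o] is
    that of the identity, so both determinants equal the same cofactor. *)
Lemma det_jacobian_fwd (H : 'I_n -> S) : H o = 0 ->
  \det (\matrix_(i < n, j < n) (fwd o H i)^`M(j)) = rjac o H.
Proof.
move=> Ho; set J := \matrix_(i, j) _; rewrite /rjac; set R := 1%:M - _.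
have rowJ j : J o j = (o == j)%:R by rewrite mxE /fwd Ho mulr0 subr0 mderivXU.
have rowR j : R o j = (o == j)%:R.
  by rewrite !mxE Ho; case: (j == o); rewrite ?mderiv0 mulr0 subr0.
have cof : cofactor J o o = cofactor R o o.
  congr (_ * \det _); apply/matrixP => i j; rewrite !mxE.
  rewrite [lift o j == o]eq_sym (negPf (neq_lift _ _)) /fwd mderivB mderivM !mderivXU.
  by rewrite (negPf (neq_lift _ _)) mul0r add0r.
by rewrite (det_row_delta rowJ) (det_row_delta rowR).
Qed.

Section Nilpotent.
Variable P : S.
Hypotheses (dP : P^`M(o) = 0) (nilP : lam_nilpotent A P).

Local Notation Q := (fun M => heat o A P M 1).
Local Notation H := (agrad P).
Local Notation N := (fun M => agrad (Q M)).

Lemma mderiv_agrad_o p i : p^`M(o) = 0 -> (agrad p i)^`M(o) = 0.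
Proof.
move=> dp; rewrite mderiv_agrad dp /agrad big1 ?scaler0 // => j _.
by rewrite mderiv0 scaler0.
Qed.

(** Nilpotency gives the Hamilton-Jacobi equation, its gradient is the Burgers equation, and
    [burgers_fixpoint] turns this into the inverse of z - t H. *)
Lemma nilpotent_fixpoint k i : eqo (wt o) k (N k i) (H i \at (bwd o (N k))).
Proof.
case: k => [//|k]; apply: burgers_fixpoint => [|l|l|l].
- exact: agrad_o.
- exact: mderiv_agrad_o.
- by apply: eqo_agrad; have := heat_init o A P k 1; rewrite divpow1.
- rewrite mderiv_agrad -agrad_bil; apply: eqo_agrad.
  by apply: heat1_hamilton_jacobi.
Qed.

(** The determinant is constant in t because div N = 2 Lambda Q = 0, and at t = 0, reached by the
    substitution [z], it is 1. *)
Lemma nilpotent_rjac : rjac o H = 1.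
Proof.
have d1 k : eqo (wt o) k (rjac o H)^`M(o) 0.
  have := mderiv_rjac (agrad_o P) (fun i => mderiv_agrad_o i dP)
    (fun i => nilpotent_fixpoint k i).
  by rewrite rdiv_agrad lam_heat1 // scaler0 comp_mpoly0 mul0r oppr0.
pose z (i : 'I_n) : S := if i == o then 0 else 'X_i.
have r1 : eqo (wt o) 1 (rjac o H) 1.
  have -> : 1 = rjac o H \at z.
    rewrite /rjac -(det_map_mx (comp_mpoly _)) -[LHS](det1 _ n); congr (\det _).
    apply/matrixP => i j.
    transitivity (((i == j)%:R - t * rJ o H i j) \at z); last by rewrite !mxE.
    by rewrite comp_mpolyB rmorphM /= atX /z eqxx mul0r subr0 rmorph_nat mxE.
  rewrite -[X in eqo _ _ X]at_id; apply: eqo_at => i; rewrite /z.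
  case: eqP => [->|//]; rewrite /eqo subr0; have := @ordwX K _ (wt o) o.
  by rewrite /wt eqxx.
apply: (@eqo_eq _ _ (wt o)) => k; apply: (@eqoS _ _ _ k.+1) => //.
apply: ordw_integral r1 _ => //.
by rewrite mderivB -mpolyC1 mderivC subr0; have := d1 k; rewrite /eqo subr0.
Qed.

(** For singular A the field 2 A grad Q does not determine Q, but it determines [b] = <grad Q, A
    grad Q>. Since d_t Q = b modulo powers of t, the coefficients of d_t Q beyond the degree of [b]
    vanish. *)
Lemma nilpotent_vanishing k0 :
  (forall M i, (k0 <= M)%N -> N M i = N k0 i) -> lam_vanishing A P.
Proof.
move=> stable; pose b := bil A (Q k0) (Q k0).
have bE M : (k0 <= M)%N -> bil A (Q M) (Q M) = b.
  (* [bil_agrad] exposes one gradient only; symmetry brings out the other. *)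
  move=> le_M; rewrite /b bil_agrad; under eq_bigr => i _ do rewrite stable //.
  rewrite -bil_agrad bilC // bil_agrad.
  by under eq_bigr => i _ do rewrite stable //; rewrite -bil_agrad.
(* With m = r + 1, Lambda^(r+1) (P^(r+2)) is up to a nonzero factor the coefficient of t^r in d_t
   Q. *)
exists (msize b).+1 => m lt_m; case: m lt_m => [//|r]; rewrite ltnS => le_r.
pose f k := (k`!)%:R^-1 *: iter k.+1 (lam A) (divpow k.+2 P).
have df k : (f k)^`M(o) = 0 by rewrite /f mderivZ mderiv_iter_lam ?scaler0.
pose M := (k0 + r).+1.
have fE : (Q M.+1)^`M(o) = \sum_(k < M) t ^+ k * f k.
  rewrite mderiv_heat // /heat raddf_sum; apply: eq_bigr => k _ /=.
  rewrite (lam_mul_const Aol Aor) => [|i ne]; last exact: mderiv_divpow_t.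
  by rewrite /f /divpow -scalerAl scalerAr.
have fb : eqo (wt o) M (\sum_(k < M) t ^+ k * f k) b.
  rewrite -fE -(@bE M.+1); last by rewrite !leqW // leq_addr.
  exact: heat1_hamilton_jacobi.
have fr : f r = 0.
  apply/mpolyP => m; rewrite mcoeff0; case: (posnP (m o)) => [mo|]; last exact: mcoeff_const.
  have ltM : (r < M)%N by rewrite ltnS leq_addl.
  rewrite -(mcoeff_series df mo ltM); have := ordwP fb (m + U_(o) *+ r)%MM.
  rewrite mcoeffB mweight_by_wt mnmDE mulmnE mnm1E eqxx mo mul1n => /(_ ltM)/subr0_eq ->.
  apply: memN_msupp_eq0; apply: contraL le_r => /msize_mdeg_lt; rewrite -ltnNge.
  by apply: leq_trans; rewrite ltnS mdegD mdegMn mdeg1 mul1n leq_addl.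
move/eqP: fr; rewrite /f /divpow iter_lamZ scalerA scaler_eq0 mulf_eq0 !invr_eq0.
by rewrite !pnatr_eq0 !gtn_eqF ?fact_gt0 //= => /eqP.
Qed.

(** The coefficient of t^k in N enters z + t N through monomials of degree above k, and [p] has none
    beyond its own degree. *)
Lemma nilpotent_stable (p : 'I_n -> S) :
  (forall d i, eqo (fun=> 1%N) d (bwd o (N d) i) (p i)) ->
  exists k0, forall M i, (k0 <= M)%N -> N M i = N k0 i.
Proof.
move=> Hp; pose f k := (k`!)%:R^-1 *: iter k (lam A) (divpow (1 + k) P).
have dg k i : (agrad (f k) i)^`M(o) = 0.
  by apply: mderiv_agrad_o; rewrite /f mderivZ mderiv_iter_lam ?scaler0.
have NE M i : N M i = \sum_(k < M) t ^+ k * agrad (f k) i.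
  rewrite /heat agrad_sum; apply: eq_bigr => k _.
  rewrite agrad_mul_const => [|j ne]; last exact: mderiv_divpow_t.
  by rewrite /divpow -scalerAl scalerAr /f agradZ.
pose k0 := (\max_i msize (p i)).+1.
have g0 k i : (k0 <= k)%N -> agrad (f k) i = 0.
  move=> le_k; apply/mpolyP => m; rewrite mcoeff0.
  case: (posnP (m o)) => [mo|]; last exact: mcoeff_const.
  (* [d] is large enough for the truncation to contain t^k and for the comparison with [p] to reach
     the monomial t m'. *)
  pose m' := (m + U_(o) *+ k)%MM; pose d := (mdeg m' + 2 + k)%N.
  have ltd : (k < d)%N by rewrite /d; lia.
  rewrite -(mcoeff_series (fun k => dg k i) mo ltd) -NE -/m'.
  have -> : (N d i)@_m' = (t * N d i)@_(U_(o) + m')%MM.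
    by rewrite [_ * N d i]mulrC addmC addmC mcoeffMX.
  have dm' : (k <= mdeg m')%N by rewrite /m' mdegD mdegMn mdeg1 mul1n leq_addl.
  have := ordwP (Hp d i) (U_(o) + m')%MM; rewrite mweight_by1 mdegD mdeg1.
  have lt1 : (1 + mdeg m' < d)%N by rewrite /d; lia.
  move=> /(_ lt1); rewrite mcoeffB /bwd mcoeffD => /eqP; rewrite subr_eq0 => /eqP.
  (* This monomial has degree at least 2, so the identity part of z + t N does not contribute. *)
  have -> : ('X_i : S)@_(U_(o) + m')%MM = 0.
    rewrite mcoeffX; case: eqP => // /(congr1 mdeg); rewrite mdegD !mdeg1.
    have : (0 < mdeg m')%N by apply: leq_trans dm'; apply: leq_trans le_k.
    by case: (mdeg m').
  rewrite add0r => ->; apply: memN_msupp_eq0.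
  apply: contraL le_k => /msize_mdeg_lt; rewrite mdegD mdeg1 add1n => lt_m.
  rewrite -ltnNge ltnS; apply: leq_trans (leq_bigmax i).
  by apply: ltnW; apply: leq_ltn_trans lt_m; apply: leqW.
exists k0 => M i le_M; rewrite !NE -(subnKC le_M) big_split_ord /=.
by rewrite [X in _ + X]big1 ?addr0 // => k _; rewrite g0 ?leq_addr // mulr0.
Qed.

End Nilpotent.
End Gradient.

(** * Laplace operators and homogeneous polynomials *)

Section Transfer.
Context (K : numFieldType).

(** The chain rule applied twice; the Jacobian matrix of [g] is constant, so no first order terms
    arise. *)
Lemma lam_at_affine (n l : nat) (L : 'M[K]_(n, l)) (g : 'I_n -> {mpoly K[l]})
    (B : 'M[K]_l) p :
  (forall i k, (g i)^`M(k) = (L i k)%:MP) ->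
  lam B (p \at g) = lam (L *m B *m L^T) p \at g.
Proof.
move=> dg; have D1 k (q : {mpoly K[n]}) :
    (q \at g)^`M(k) = \sum_i L i k *: (q^`M(i) \at g).
  rewrite mderiv_at; apply: eq_bigr => i _.
  by rewrite dg mulrC mul_mpolyC.
transitivity (\sum_k \sum_m \sum_j \sum_i
    (L i k * B k m * L j m) *: (p^`M(j)^`M(i) \at g)).
  apply: eq_bigr => k _; apply: eq_bigr => m _.
  rewrite D1 (raddf_sum (mderiv k)) scaler_sumr; apply: eq_bigr => j _ /=.
  rewrite mderivZ D1 !scaler_sumr; apply: eq_bigr => i _.
  by rewrite !scalerA; congr (_ *: _); ring.
rewrite /lam raddf_sum /=.
under [RHS]eq_bigr => i _ do rewrite raddf_sum /=.
under [RHS]eq_bigr => i _ do under eq_bigr => j _ do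
  rewrite comp_mpolyZ mxE scaler_suml.
under [RHS]eq_bigr => i _ do rewrite exchange_big.
rewrite [RHS]exchange_big [LHS]exchange_big /=; apply: eq_bigr => m _.
under [RHS]eq_bigr => i _ do under eq_bigr => j _ do rewrite mxE mulr_suml scaler_suml.
under [RHS]eq_bigr => i _ do rewrite exchange_big.
rewrite [RHS]exchange_big /=; apply: eq_bigr => k _.
rewrite [RHS]exchange_big /=; apply: eq_bigr => j _; apply: eq_bigr => i _.
by rewrite !mxE.
Qed.

Lemma iter_lam_at_affine (n l : nat) (L : 'M[K]_(n, l)) (g : 'I_n -> {mpoly K[l]})
    (B : 'M[K]_l) m p :
  (forall i k, (g i)^`M(k) = (L i k)%:MP) ->
  iter m (lam B) (p \at g) = iter m (lam (L *m B *m L^T)) p \at g.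
Proof.
by move=> dg; elim: m => [//|m IHm]; rewrite !iterS IHm (lam_at_affine _ _ dg).
Qed.

Lemma homog_at (n l : nat) (g : 'I_n -> {mpoly K[l]}) (p : {mpoly K[n]}) d :
  (forall i, g i \is 1.-homog) -> p \is d.-homog -> p \at g \is d.-homog.
Proof.
move=> Hg /dhomogP Hp; rewrite comp_mpolyE big_seq.
apply: rpred_sum => m pm; apply: rpredZ; have := Hp _ pm => /= <-.
rewrite mdegE; elim/big_ind2: _ => [|d1 p1 d2 p2 H1 H2|i _]; first exact: dhomog1.
  exact: dhomogM.
by rewrite tnth_mktuple; have := @dhomogMn _ _ mdeg 1 (g i) (m i); rewrite mul1n; apply.
Qed.

Lemma homog_mderiv (n : nat) (p : {mpoly K[n]}) d i :
  p \is d.-homog -> p^`M(i) \is d.-1.-homog.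
Proof.
move=> Hp; apply/dhomogP => m; rewrite mcoeff_msupp mcoeff_mderiv.
apply: contraNeq => ne; rewrite (dhomog_nemf_coeff Hp) ?mul0rn //= mdegD mdeg1 addn1.
by apply: contra ne => /eqP <-.
Qed.

Lemma homog_lam (n : nat) (A : 'M[K]_n) (p : {mpoly K[n]}) d :
  p \is d.-homog -> lam A p \is d.-2.-homog.
Proof.
move=> Hp; apply: rpred_sum => i _; apply: rpred_sum => j _; apply: rpredZ.
by do 2!apply: homog_mderiv.
Qed.

(* z = L w with L = [(A + 1) / 2, i (A - 1) / 2] satisfies L L^T = A, and L has a
   right inverse even when A is singular. *)
Lemma laplace_substitution (iota : K) (n : nat) (A : 'M[K]_n) :
  iota ^+ 2 = -1 -> A^T = A ->
  exists (g : 'I_n -> {mpoly K[n + n]}) (r : 'I_(n + n) -> {mpoly K[n]}),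
  [/\ forall m p, iter m (lam 1%:M) (p \at g) = iter m (lam A) p \at g,
      forall p, p \at g \at r = p
    & forall p d, p \is d.-homog -> p \at g \is d.-homog].
Proof.
move=> iota2 At.
(* L L^T = ((A + 1)^2 - (A - 1)^2) / 4 = A and L R = (A + 1) / 2 - (A - 1) / 2 = 1. *)
pose M := 2^-1 *: (A + 1%:M); pose N := (iota / 2) *: (A - 1%:M).
pose L := row_mx M N; pose R : 'M_(n + n, n) := col_mx 1%:M (iota *: 1%:M).
pose lin m l (B : 'M[K]_(m, l)) i : {mpoly K[l]} := \sum_k B i k *: 'X_k.
have two0 : (2 : K) != 0 by rewrite pnatr_eq0.
have LL : L *m 1%:M *m L^T = A.
  have Mt : M^T = M by rewrite /M linearZ /= linearD /= At trmx1.
  have Nt : N^T = N by rewrite /N linearZ /= linearB /= At trmx1.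
  rewrite mulmx1 tr_row_mx mul_row_col Mt Nt /M /N.
  have h2 : iota / 2 * (iota / 2) = - (2^-1 * 2^-1).
    by rewrite mulrACA -expr2 iota2 mulN1r.
  rewrite -!scalemxAl -!scalemxAr !scalerA h2 scaleNr -scalerBr.
  rewrite mulmxBl mulmxDl !mulmxBr !mulmxDr !mul1mx !mulmx1.
  by apply/matrixP => i j; rewrite !mxE; field.
have LR : L *m R = 1%:M.
  rewrite mul_row_col mulmx1 -scalemxAr mulmx1 /M /N scalerA mulrA -expr2 iota2.
  by apply/matrixP => i j; rewrite !mxE; field.
have dlin m l (B : 'M[K]_(m, l)) i k : (lin m l B i)^`M(k) = (B i k)%:MP.
  rewrite /lin raddf_sum (bigD1 k) //= mderivZ mderivXU eqxx big1 => [|j ne].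
    by rewrite addr0 -mul_mpolyC mulr1.
  by rewrite mderivZ mderivXU (negPf ne) scaler0.
exists (lin _ _ L), (lin _ _ R); split=> [m p|p|p d].
- by rewrite (iter_lam_at_affine _ _ _ (dlin _ _ L)) LL.
- rewrite at_at -[RHS]at_id; apply: eq_at => i.
  rewrite /lin raddf_sum /=.
  under eq_bigr => k _ do rewrite comp_mpolyZ atX scaler_sumr.
  rewrite exchange_big /= (bigD1 i) //= [X in _ + X]big1 ?addr0 => [|j ne].
    under eq_bigr => k _ do rewrite scalerA.
    rewrite -scaler_suml; have /matrixP/(_ i i) := LR.
    by rewrite !mxE eqxx => ->; rewrite scale1r.
  under eq_bigr => k _ do rewrite scalerA.
  rewrite -scaler_suml; have /matrixP/(_ i j) := LR.
  by rewrite !mxE eq_sym (negPf ne) => ->; rewrite scale0r.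
- apply: homog_at => i; apply: rpred_sum => k _; apply: rpredZ.
  by rewrite dhomogX /= mdeg1.
Qed.

Section ExtraVariable.
Context (n : nat).

Definition up (p : {mpoly K[n]}) : {mpoly K[1 + n]} := p \at (fun i => 'X_(rshift 1 i)).

Definition dehom (p : {mpoly K[1 + n]}) : {mpoly K[n]} :=
  p \at (glue (fun=> 1) (fun i => 'X_i)).

Definition up_mx (A : 'M[K]_n) : 'M[K]_(1 + n) := block_mx 0 0 0 A.

Lemma up_mx_sym A : A^T = A -> (up_mx A)^T = up_mx A.
Proof. by move=> At; rewrite /up_mx tr_block_mx !trmx0 At. Qed.

Lemma dehom_up p : dehom (up p) = p.
Proof. by rewrite /dehom /up at_at -[RHS]at_id; apply: eq_at => i; rewrite atX glue_r. Qed.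

Lemma iter_lam_up A m p : iter m (lam (up_mx A)) (up p) = up (iter m (lam A) p).
Proof.
rewrite /up (iter_lam_at_affine (L := row_mx 0 1%:M)).
  rewrite tr_row_mx trmx0 trmx1 -mulmxA (mul_block_col 0 0 0 A) !mul0mx mul_row_col.
  by rewrite mul0mx mul1mx mulmx1 !add0r.
move=> i k; case: (split_ordP k) => j ->; rewrite mderivXU.
  by rewrite row_mxEl mxE eq_rlshift mpolyC0.
by rewrite row_mxEr mxE (inj_eq (@rshift_inj _ _)) mpolyC_nat.
Qed.

Lemma iter_lam_dehom A m p : iter m (lam A) (dehom p) = dehom (iter m (lam (up_mx A)) p).
Proof.
rewrite /dehom (iter_lam_at_affine (L := col_mx 0 1%:M)).
  rewrite mul_col_mx mul0mx mul1mx tr_col_mx trmx0 trmx1 mul_col_row.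
  by rewrite !mul0mx mulmx0 mulmx1.
move=> i k; case: (split_ordP i) => j ->; rewrite ?glue_l ?glue_r ?col_mxEu ?col_mxEd mxE.
  by rewrite -mpolyC1 mderivC mpolyC0.
by rewrite mderivXU mpolyC_nat.
Qed.

Lemma homogenization p : exists d q, q \is d.-homog /\ dehom q = p.
Proof.
pose t : {mpoly K[1 + n]} := 'X_(lshift n ord0).
exists (msize p), (\sum_(m <- msupp p) p@_m *: (t ^+ (msize p - mdeg m) * up 'X_[m])).
split.
  rewrite big_seq; apply: rpred_sum => m pm; apply: rpredZ.
  have le_m : (mdeg m <= msize p)%N by rewrite ltnW // msize_mdeg_lt.
  have Ht : t ^+ (msize p - mdeg m) \is (msize p - mdeg m).-homog.
    have := @dhomogMn _ _ mdeg 1 t (msize p - mdeg m); rewrite mul1n; apply.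
    by rewrite dhomogX /= mdeg1.
  have Hu : up 'X_[m] \is (mdeg m).-homog.
    by apply: homog_at => [i|]; rewrite dhomogX //= mdeg1.
  by have := dhomogM Ht Hu; rewrite subnK.
rewrite [RHS]mpolyE /dehom raddf_sum; apply: eq_bigr => m _ /=.
rewrite comp_mpolyZ rmorphM rmorphXn /= atX glue_l expr1n mul1r -/(dehom _).
by rewrite dehom_up.
Qed.

(** In a fixed degree the other exponents determine that of the extra variable, so distinct
    monomials stay distinct. *)
Lemma dehom_inj p d : p \is d.-homog -> dehom p = 0 -> p = 0.
Proof.
move=> /dhomogP Hp p0; apply/eqP; case: (eqVneq p 0) => // /mlead_supp.
set m0 := mlead p => pm0.
pose r (m : 'X_{1..1 + n}) : 'X_{1..n} := [multinom m (rshift 1 i) | i < n].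
have Xr m : dehom 'X_[m] = 'X_[r m].
  rewrite /dehom comp_mpolyX big_split_ord /= big1 ?mul1r => [|i _].
    rewrite [RHS]mpolyXE_id; apply: eq_bigr => i _.
    by rewrite tnth_mktuple glue_r mnmE.
  by rewrite tnth_mktuple glue_l expr1n.
have r_inj m : m \in msupp p -> r m = r m0 -> m = m0.
  move=> pm /mnmP rE; have E i : m (rshift 1 i) = m0 (rshift 1 i).
    by have := rE i; rewrite !mnmE.
  apply/mnmP => k; case: (split_ordP k) => j ->; last exact: E.
  have := Hp _ pm; rewrite -(Hp _ pm0) /= !mdegE !big_split_ord /= !big_ord1.
  by rewrite (eq_bigr _ (fun i _ => E i)) (ord1 j) => /addIn.
have pE : dehom p = \sum_(m <- msupp p) p@_m *: 'X_[r m].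
  rewrite {1}[p]mpolyE /dehom raddf_sum; apply: eq_bigr => m _ /=.
  by rewrite comp_mpolyZ -/(dehom _) Xr.
have := congr1 (mcoeff (r m0)) p0; rewrite mcoeff0 pE.
rewrite raddf_sum (bigD1_seq m0) //= mcoeffZ mcoeffX eqxx mulr1.
rewrite big_seq_cond big1 ?addr0 => [p00|m /andP[pm ne]]; last first.
  rewrite mcoeffZ mcoeffX; case: eqP => [/(r_inj _ pm) E|]; last by rewrite mulr0.
  by rewrite E eqxx in ne.
by move: pm0; rewrite mcoeff_msupp p00 eqxx.
Qed.

End ExtraVariable.

(* P is homogenized with a variable that the operator does not involve. *)
Lemma homogeneous_reduction :
  (forall n : nat, (1 <= n)%N -> forall A : 'M[K]_n, A^T = A ->
     forall P d, P \is d.-homog -> lam_nilpotent A P -> lam_vanishing A P) ->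
  VC_quadratic K.
Proof.
move=> HVCq n n_gt0 A At P nilP; have [d [Q [Qd QP]]] := homogenization P.
have hom m e q : q \is e.-homog -> exists e', iter m (lam (up_mx A)) q \is e'.-homog.
  move=> qe; elim: m => [|m [e' IHm]]; first by exists e.
  by exists e'.-2; rewrite iterS; apply: homog_lam.
have nilQ : lam_nilpotent (up_mx A) Q.
  move=> m m_gt0; have [e He] := hom m _ _ (dhomogMn m Qd).
  apply: (dehom_inj He).
  rewrite -iter_lam_dehom /dehom rmorphXn /= -/(dehom _) QP.
  exact: nilP.
have [k0 Hk0] := HVCq (1 + n)%N isT _ (up_mx_sym At) _ _ Qd nilQ.
exists k0 => m le_m; rewrite -QP /dehom -rmorphXn /= -/(dehom _) iter_lam_dehom.
by rewrite Hk0 // /dehom comp_mpoly0.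
Qed.

End Transfer.

(** * The Jacobian conjecture in terms of truncated inverses *)

Section Truncation.
Context (K : numFieldType).

Lemma ordw_mono (n : nat) (w v : 'I_n -> nat) k (p : {mpoly K[n]}) :
  (forall i, (w i <= v i)%N) -> ordw w k p -> ordw v k p.
Proof.
move=> wv /ordwP Hp; apply/ordwP => m lt_m; apply: Hp.
by apply: leq_ltn_trans lt_m; apply: leq_sum => i _; rewrite leq_mul2r wv orbT.
Qed.

(* JC for maps fixing the origin, the formal inverse being presented by the
   polynomials G d that agree with it up to degree d. *)
Definition JC_truncated := forall n : nat, (1 <= n)%N ->
  forall F : 'I_n -> {mpoly K[n]},
  \det (\matrix_(i < n, j < n) (F i)^`M(j)) = 1 -> (forall i, (F i)@_0%MM = 0) ->
  forall G : nat -> 'I_n -> {mpoly K[n]},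
  (forall d i, (G d i)@_0%MM = 0) ->
  (forall d e i, (d <= e)%N -> eqo (fun=> 1%N) d (G d i) (G e i)) ->
  (forall d i, eqo (fun=> 1%N) d (F i \at (G d)) 'X_i) ->
  (forall d i, eqo (fun=> 1%N) d (G d i \at F) 'X_i) ->
  exists p : 'I_n -> {mpoly K[n]}, forall d i, eqo (fun=> 1%N) d (G d i) (p i).

(** After adjoining t, z - t H has Jacobian determinant 1 and truncated inverses z + t N. A
    polynomial inverse makes N stabilize by [nilpotent_stable], and [nilpotent_vanishing]
    concludes. *)
Lemma JC_truncated_VC : JC_truncated -> VC_quadratic K.
Proof.
move=> JCt n n_gt0 A At P nilP; pose o := lshift n (ord0 : 'I_1).
have At' := up_mx_sym At; pose P' := up P.
have Aol j : up_mx A o j = 0.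
  by case: (split_ordP j) => k ->; rewrite /up_mx ?block_mxEul ?block_mxEur mxE.
have dP : P'^`M(o) = 0.
  by rewrite /P' /up mderiv_at big1 // => i _; rewrite mderivXU eq_rlshift mulr0.
have nilP' : lam_nilpotent (up_mx A) P'.
  move=> m m_gt0; rewrite /P' /up -rmorphXn /= -/(up _) iter_lam_up nilP //.
  by rewrite /up comp_mpoly0.
suff [k0 Hk0] : lam_vanishing (up_mx A) P'.
  exists k0 => m le_m; rewrite -[LHS]dehom_up -iter_lam_up /up rmorphXn /= -/(up _).
  by rewrite Hk0 // /dehom comp_mpoly0.
pose H := agrad (up_mx A) P'; pose N M := agrad (up_mx A) (heat o (up_mx A) P' M 1).
have Ho : H o = 0 by apply: agrad_o.
have No M : N M o = 0 by apply: agrad_o.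
(* The exponent of t is at most the total degree, so a congruence modulo t^d also holds to order d
   at the origin. *)
have w1 i : (wt o i <= 1)%N by rewrite /wt leq_b1.
have fix_N d i : eqo (wt o) d (N d i) (H i \at (bwd o (N d))).
  exact: nilpotent_fixpoint.
have X0 i : ('X_i : {mpoly K[1 + n]})@_0%MM = 0 by rewrite mcoeffX mnm1_eq0.
have [|i|d i|d e i le_de|d i|d i|p Hp] :=
  JCt (1 + n)%N isT (fwd o H) _ _ (fun d => bwd o (N d)).
- by rewrite det_jacobian_fwd //; apply: nilpotent_rjac.
- by rewrite /fwd mcoeffB X0 rmorphM /= X0 mul0r subr0.
- by rewrite /bwd mcoeffD X0 rmorphM /= X0 mul0r addr0.
- apply: (@ordw_mono _ (wt o)) => //; apply: (@eqoS _ _ _ d.+1) => //.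
  by apply: eqo_bwd; apply: eqo_agrad => //; apply: heat_leq.
- apply: (@ordw_mono _ (wt o)) => //; apply: (@eqoS _ _ _ d.+1) => //.
  exact: fixpoint_bwd.
- apply: (@ordw_mono _ (wt o)) => //; apply: (@eqoS _ _ _ d.+1) => //.
  exact: fixpoint_fwd_bwd.
have [k0 Hk0] := nilpotent_stable At' Aol dP Hp.
exact: (nilpotent_vanishing At' Aol dP nilP' Hk0).
Qed.

End Truncation.

(** * Formal inverses *)

Section Jacobian.
Context (R : realType).
Local Notation C := (R[i] : numFieldType).

Lemma mcoeff_fps_trunc n d (f : fps R n) m : (mdeg m < d)%N -> (fps_trunc d f)@_m = f m.
Proof. exact: mcoeff_mpoly. Qed.

Lemma eqo_degP n d (p q : {mpoly C[n]}) :
  reflect (forall m, (mdeg m < d)%N -> p@_m = q@_m) (eqo (fun=> 1%N) d p q).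
Proof.
apply: (iffP ordwP) => H m lt_m.
  by apply: subr0_eq; rewrite -mcoeffB; apply: H; rewrite mweight_by1.
by rewrite mcoeffB H ?subrr -?mweight_by1.
Qed.

Lemma ordw_deg1 n (p : {mpoly C[n]}) : p@_0%MM = 0 -> ordw (fun=> 1%N) 1 p.
Proof.
move=> p0; have : eqo (fun=> 1%N) 1 p 0.
  by apply/eqo_degP => m; rewrite ltnS leqn0 mdeg_eq0 mcoeff0 => /eqP ->.
by rewrite /eqo subr0.
Qed.

(** Since the [q i] have no constant term, substitution moves no term of degree d or more below d;
    hence any polynomials correct below degree d compute the composition there. *)
Lemma fps_compE n d (f : fps R n) (g : 'I_n -> fps R n) (p : {mpoly C[n]})
    (q : 'I_n -> {mpoly C[n]}) :
  (forall m, (mdeg m < d)%N -> p@_m = f m) ->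
  (forall i m, (mdeg m < d)%N -> (q i)@_m = g i m) ->
  (forall i, (q i)@_0%MM = 0) ->
  forall m, (mdeg m < d)%N -> fps_comp f g m = (p \at q)@_m.
Proof.
move=> pf qg q0 m lt_m; rewrite /fps_comp; set e := (mdeg m).+1.
have lt_e m' : (mdeg m' < e)%N -> (mdeg m' < d)%N by move/leq_trans; apply.
have E : eqo (fun=> 1%N) e (fps_trunc e f \at (fun i => fps_trunc e (g i))) (p \at q).
  apply: (@eqo_trans _ _ _ _ (fps_trunc e f \at q)).
    apply: eqo_at => i; apply/eqo_degP => m' lt_m'.
    by rewrite mcoeff_fps_trunc // qg // lt_e.
  apply: eqo_at_l => [i|]; first exact: ordw_deg1.
  by apply/eqo_degP => m' lt_m'; rewrite mcoeff_fps_trunc // pf // lt_e.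
by move/eqo_degP: E; apply.
Qed.

Lemma JC_JC_truncated : JC R -> JC_truncated C.
Proof.
move=> jc n n_gt0 F J1 F0 G G0 Gcoh FG GF.
(* The limit of the [G d]: by coherence, every truncation beyond the degree of m has the same
   coefficient at m. *)
pose g i : fps R n := fun m => (G (mdeg m).+1 i)@_m.
have Gg d i m : (mdeg m < d)%N -> (G d i)@_m = g i m.
  by move=> lt_m; rewrite /g; have /eqo_degP -> := Gcoh _ _ i lt_m.
have cF d i m : (mdeg m < d)%N -> (F i)@_m = centered F i m.
  by rewrite /centered F0 mpolyC0 subr0.
have /fin_all_exists[h Hh] : is_polynomial_map g.
  apply: (jc n n_gt0 F J1); split=> [i|i m|i m].
  - by rewrite /g G0.
  - rewrite (fps_compE (cF (mdeg m).+1 i) (Gg (mdeg m).+1)) //.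
    by have /eqo_degP -> := FG (mdeg m).+1 i.
  - rewrite (fps_compE (Gg (mdeg m).+1 i) (cF (mdeg m).+1)) //.
    by have /eqo_degP -> := GF (mdeg m).+1 i.
by exists h => d i; apply/eqo_degP => m lt_m; rewrite Gg // Hh.
Qed.

(** A polynomial left inverse g of F - F(0) coincides with G, because G = g((F - F(0))(G)) = g in
    each degree. *)
Lemma VC_JC : VC_quadratic C -> JC R.
Proof.
move=> VCq n _ F J1 G [G0 FG _] i.
have [g Hg] := keller_left_inverse VCq J1.
exists (g i) => m; pose d := (mdeg m).+1; pose q l := fps_trunc d (G l).
pose Fc l := F l - ((F l)@_0%MM)%:MP.
have q0 l : (q l)@_0%MM = 0 by rewrite mcoeff_fps_trunc ?mdeg0 // G0.
have FE l : eqo (fun=> 1%N) d (Fc l \at q) 'X_l.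
  apply/eqo_degP => m' lt_m'.
  rewrite -(@fps_compE _ d (centered F l) G) ?FG // => k e lt_e.
  by rewrite mcoeff_fps_trunc.
transitivity ((q i)@_m); first by rewrite mcoeff_fps_trunc.
have E : q i = g i \at (fun l => Fc l \at q).
  by have := congr1 (comp_mpoly [tuple q l | l < n]) (Hg i); rewrite at_at atX.
have /eqo_degP : eqo (fun=> 1%N) d (q i) (g i).
  by rewrite E -[X in eqo _ _ _ X]at_id; apply: eqo_at.
by apply.
Qed.

Lemma diffop2_lam n (L : {mpoly R[i][n]} -> {mpoly R[i][n]}) : is_diffop2 L ->
  exists A : 'M[C]_n, A^T = A /\ forall m p, iter m L p = iter m (lam A) p.
Proof. by move=> [A [At LA]]; exists A; split=> // m; apply: eq_iter. Qed.

Lemma laplacian_lam n : @laplacian R n =1 lam (1%:M : 'M[C]_n).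
Proof.
move=> p; apply: eq_bigr => i _; rewrite (bigD1 i) //= mxE eqxx scale1r.
by rewrite big1 ?addr0 // => j ne; rewrite mxE eq_sym (negPf ne) scale0r.
Qed.

Lemma laplacian_diffop2 n : is_diffop2 (@laplacian R n).
Proof. by exists 1%:M; split; [exact: trmx1 | exact: laplacian_lam]. Qed.

Lemma VC_HVC n (L : {mpoly R[i][n]} -> {mpoly R[i][n]}) : VC L -> HVC L.
Proof. by move=> vc P _; apply: vc. Qed.

Lemma VC_quadratic_diffop2 n (L : {mpoly R[i][n]} -> {mpoly R[i][n]}) :
  VC_quadratic C -> (1 <= n)%N -> is_diffop2 L -> VC L.
Proof.
move=> VCq n_gt0 /diffop2_lam[A [At LA]] P nilP.
have [|k0 Hk0] := VCq n n_gt0 A At P; first by move=> m m_gt0; rewrite -LA nilP.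
by exists k0 => m le_m; rewrite LA Hk0.
Qed.

(** P is first made homogeneous, then pulled back to 2n variables where Lambda becomes the Laplace
    operator. The pullback keeps P homogeneous, and its left inverse [r] carries the vanishing
    back. *)
Lemma HVC_laplacian_VC_quadratic :
  (forall n, (1 <= n)%N -> HVC (@laplacian R n)) -> VC_quadratic C.
Proof.
move=> hvc; apply: homogeneous_reduction => n n_gt0 A At P d Pd nilP.
have lapE l m p : iter m (@laplacian R l) p = iter m (lam (1%:M : 'M[C]_l)) p.
  by apply: eq_iter; apply: laplacian_lam.
have [g [r [Lg gr homg]]] := laplace_substitution (sqrCi _ : 'i ^+ 2 = -1 :> C) At.
have [k0 Hk0] : eventually_vanishing (@laplacian R (n + n)) (P \at g).
  apply: hvc; [by rewrite addn_gt0 n_gt0 | by exists d; apply: homg |].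
  by move=> m m_gt0; rewrite lapE -rmorphXn /= Lg nilP // comp_mpoly0.
exists k0 => m le_m; rewrite -[LHS]gr -Lg rmorphXn /= -lapE Hk0 //.
by rewrite comp_mpoly0.
Qed.

End Jacobian.

Theorem theorem2p9 (R : realType) :
  [<-> JC R;
       forall n : nat, (1 <= n)%N -> HVC (@laplacian R n);
       forall n : nat, (1 <= n)%N -> VC (@laplacian R n);
       forall n : nat, (1 <= n)%N ->
         forall L : {mpoly R[i][n]} -> {mpoly R[i][n]}, is_diffop2 L -> HVC L;
       forall n : nat, (1 <= n)%N ->
         forall L : {mpoly R[i][n]} -> {mpoly R[i][n]}, is_diffop2 L -> VC L].
Proof.
(* Each implication passes through [VC_quadratic], the vanishing conjecture for all symmetric A in
   all dimensions. *)
tfae=> [jc n n_gt0|hvc n n_gt0|vc n n_gt0 L dL|hvc n n_gt0 L dL|vc].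
- apply: VC_HVC; apply: VC_quadratic_diffop2 (laplacian_diffop2 R n) => //.
  exact/JC_truncated_VC/JC_JC_truncated.
- apply: VC_quadratic_diffop2 (laplacian_diffop2 R n) => //.
  exact: HVC_laplacian_VC_quadratic.
- apply: VC_HVC; apply: VC_quadratic_diffop2 dL => //.
  by apply: HVC_laplacian_VC_quadratic => l l_gt0; apply/VC_HVC/vc.
- apply: VC_quadratic_diffop2 dL => //.
  apply: HVC_laplacian_VC_quadratic => l l_gt0.
  by apply: hvc => //; apply: laplacian_diffop2.
- apply: VC_JC; apply: HVC_laplacian_VC_quadratic => l l_gt0.
  by apply: VC_HVC; apply: vc => //; apply: laplacian_diffop2.
Qed.
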